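(* Let $v=(v^1,v^2,v^3)\in C_0^\infty(\mathbb{R}^3;\mathbb{R}^3)$ and $p\in C_0^\infty(\mathbb{R}^3)$ satisfy $$\sum_{j=1}^3\frac{\partial (v^iv^j)}{\partial x_j}+\frac{\partial p}{\partial x_i}=0\quad (i=1,2,3),\qquad \operatorname{div} v=0 ,$$ and suppose that the function $w$ on the manifold $M$ of oriented affine lines of $\mathbb{R}^3$ associated with $(v,p)$ vanishes everywhere on $M$. Then $v=0$ and $p=0$ everywhere on $\mathbb{R}^3$.
   Context: $C_0^\infty$ denotes smooth compactly supported functions. $M$ is the manifold of oriented affine lines in $\mathbb{R}^3$ (identified with the tangent bundle $T\mathbb{S}^2$). For a smooth compactly supported solution $(v,p)$ of $\sum_{j}\partial_{x_j}(v^iv^j)+\partial_{x_i}p=0$, $i=1,2,3$, the function $w:M\to\mathbb{R}$ is defined by $$w(m)= -\int_{H(m)}\langle e_m,v\rangle \langle\nu_{H(m)},v\rangle \,d\sigma_{H(m)},$$ where $e_m$ is the positive unit direction vector of $m$, $H(m)$ is any half-plane in $\mathbb{R}^3$ with boundary line $\partial H(m)=m$, $d\sigma_{H(m)}$ is its area element, and $\nu_{H(m)}$ is the unit normal to $H(m)$ such that $(e_m,\nu_m,\nu_{H(m)})$ is a positively oriented basis, $\nu_m$ being the unit vector parallel to $H(m)$, perpendicular to $m$, and pointing from $m$ into $H(m)$. For a solution $(v,p)$ the value does not depend on the choice of $H(m)$. *)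

(* Defs.v *)
From HB Require Import structures.
From mathcomp Require Import all_boot all_order all_algebra.
From mathcomp Require Import all_classical all_reals all_analysis.

Set Implicit Arguments.
Unset Strict Implicit.
Unset Printing Implicit Defensive.

Import Order.TTheory GRing.Theory Num.Theory.
Import numFieldNormedType.Exports.

Local Open Scope classical_set_scope.
Local Open Scope ring_scope.

Section Defs.
Variable R : realType.
Local Notation E3 := 'rV[R]_3.

(* The norm `|x| of 'rV[R]_3 is the sup norm, so Euclidean unit vectors are
   the e with dot e e = 1. *)
Definition dot (x y : E3) : R := \sum_(i < 3) x ord0 i * y ord0 i.

Definition partial (i : 'I_3) (f : E3 -> R) : E3 -> R :=
  fun x => 'D_(delta_mx ord0 i) f x.

Definition iter_partial (s : seq 'I_3) (f : E3 -> R) : E3 -> R :=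
  foldr partial f s.

(* 'D is a total function, so the existence of each iterated partial
   derivative is required separately, as a derivability condition. *)
Definition smooth (f : E3 -> R) : Prop :=
  forall s : seq 'I_3,
    continuous (iter_partial s f) /\
    forall (i : 'I_3) (x : E3),
      derivable (iter_partial s f) x (delta_mx ord0 i).

Definition compactly_supported (f : E3 -> R) : Prop :=
  compact (closure [set x | f x != 0]).

Definition test_function (f : E3 -> R) : Prop :=
  smooth f /\ compactly_supported f.

Definition component (v : E3 -> E3) (i : 'I_3) : E3 -> R :=
  fun x => v x ord0 i.

Definition test_field (v : E3 -> E3) : Prop :=
  forall i : 'I_3, test_function (component v i).

Definition divergence (v : E3 -> E3) (x : E3) : R :=
  \sum_(j < 3) partial j (component v j) x.

(* An oriented affine line is given by its positive unit direction e and its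
   point b closest to the origin; the pairs (e, b) with |e| = 1 and <b, e> = 0
   form the tangent bundle of the unit sphere, and each oriented line
   corresponds to exactly one such pair. *)
Record oriented_line : Type := OrientedLine {
  direction : E3;
  base_point : E3;
  direction_unit : dot direction direction = 1;
  base_point_orth : dot base_point direction = 0
}.

(* A half-plane with boundary m is given by the unit vector parallel to it,
   perpendicular to m and pointing from m into it; the unit normal is fixed by
   the requirement that (direction m, inward, normal) be a positively oriented
   basis. *)
Record half_plane (m : oriented_line) : Type := HalfPlane {
  inward : E3;
  normal : E3;
  inward_unit : dot inward inward = 1;
  inward_orth : dot inward (direction m) = 0;
  normal_unit : dot normal normal = 1;
  normal_orth_direction : dot normal (direction m) = 0;
  normal_orth_inward : dot normal inward = 0;
  positively_oriented :
    0 < \det (\matrix_(i < 3)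
               (nth 0 [:: direction m; inward; normal] i : E3))
}.

Definition half_plane_point (m : oriented_line) (h : half_plane m)
    (z : R * R) : E3 :=
  base_point m + z.1 *: direction m + z.2 *: inward h.

(* The map (s, t) |-> half_plane_point h (s, t) is an isometry from
   {t >= 0} in the Euclidean plane onto the half-plane, so the area element of
   the half-plane is the image of the planar Lebesgue measure. *)
Definition half_plane_integral (m : oriented_line) (h : half_plane m)
    (f : E3 -> R) : R :=
  \int[(lebesgue_measure \x lebesgue_measure)%E]_(z in
      [set z : R * R | 0 <= z.2]) f (half_plane_point h z).

Definition w (v : E3 -> E3) (H : forall m : oriented_line, half_plane m)
    (m : oriented_line) : R :=
  - half_plane_integral (H m)
      (fun x => dot (direction m) (v x) * dot (normal (H m)) (v x)).

End Defs.

(* Main.v *)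
Require Import Defs.
From mathcomp Require Import all_boot all_order all_algebra.
From mathcomp Require Import all_classical all_reals all_analysis.
From mathcomp Require Import ring lra.
Set Implicit Arguments.
Unset Strict Implicit.
Unset Printing Implicit Defensive.
Import Order.TTheory GRing.Theory Num.Theory.
Import numFieldNormedType.Exports.
Local Open Scope classical_set_scope.
Local Open Scope ring_scope.

(** The tensor T = v (x) v + p I is symmetric and, by the Euler equation, free
    of divergence. Hence, for every direction e, the field T e is free of
    divergence, w is its flux through a half-plane bounded by a line of
    direction e, and this flux does not depend on the half-plane: it is a stream
    function on the space of lines of direction e, whose gradient is T e
    integrated along these lines. If w vanishes then so does this gradient, that
    is, <e, v> <n, v> has integral zero along every line of direction e, for
    every n orthogonal to e ([flux_lines], [stress_lines_ray]).

    In terms of the Fourier transform, this says that the transform of v (x) v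
    at xi has the form a xi (x) xi + b I, and the Euler equation expresses b by a
    and the transform of p. Together they say that
    S = v (x) v - (|v|^2 + p)/2 I is a Hessian matrix; in particular
    d_k S_ij = d_i S_kj ([codazzi]). Here this is derived from the moments
    against ridge polynomials <w, x>^k, in place of exponentials: the same linear
    algebra applies at each w ([moment_unit]), and a continuous function of
    compact support all of whose ridge moments vanish is zero, because ridge
    polynomials span all polynomials and powers of 1 - r |x - a|^2 are an
    approximate identity at a ([ridge_eq0]).

    The symmetry of d_k S_ij determines the gradient A of v where v is not zero:
    with u = A v, contraction with v gives
    |v|^2 A = u (x) v + v (x) u / 2 - <u, v>/2 I ([gradient_formula]), hence
    |v|^4 tr(A^2) = <u, v>^2 / 2 + |v|^2 |u|^2 ([gradient_trace]). So tr(A^2),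
    which is minus the Laplacian of p as div v = 0, is nonnegative; being a
    divergence, it has integral zero, and therefore it vanishes. Then u = 0: the
    pressure has zero gradient, so p = 0, and |v|^2 A = 0, so |v|^4 is constant
    and v = 0. *)

(** * Continuity of real-valued functions *)

Section Continuity.
Variables (R : realType) (T : topologicalType).
Implicit Types f g : T -> R.

Lemma cont_cst (k : R) : continuous (fun _ : T => k).
Proof. by move=> x; exact: cvg_cst. Qed.

Lemma contD f g : continuous f -> continuous g -> continuous (fun x => f x + g x).
Proof. by move=> cf cg x; exact: (cvgD (cf x) (cg x)). Qed.

Lemma contN f : continuous f -> continuous (fun x => - f x).
Proof. by move=> cf x; exact: (cvgN (cf x)). Qed.

Lemma contM f g : continuous f -> continuous g -> continuous (fun x => f x * g x).
Proof. by move=> cf cg x; exact: (cvgM (cf x) (cg x)). Qed.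

Lemma contZ k f : continuous f -> continuous (fun x => k * f x).
Proof. by move=> cf; apply: contM => //; exact: cont_cst. Qed.

Lemma contX f n : continuous f -> continuous (fun x => f x ^+ n).
Proof.
move=> cf; elim: n => [|n IH]; first exact: cont_cst.
by under eq_fun do rewrite exprS; exact: contM.
Qed.

Lemma cont_sum (I : Type) (r : seq I) (F : I -> T -> R) :
  (forall i, continuous (F i)) -> continuous (fun x => \sum_(i <- r) F i x).
Proof.
move=> cF; elim: r => [|i r IH].
  by under eq_fun do rewrite big_nil; exact: cont_cst.
by under eq_fun do rewrite big_cons; exact: contD.
Qed.

End Continuity.

(** * Integrals of continuous functions on intervals and rectangles *)

Section OneDim.
Variable R : realType.
Notation mu := (@lebesgue_measure R).
Implicit Types (g : R -> R) (a b c : R).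

Lemma cont_integrable g a b : continuous g -> mu.-integrable `[a, b] (EFin \o g).
Proof.
move=> cg; apply: continuous_compact_integrable; first exact: segment_compact.
exact: continuous_subspaceT.
Qed.

Definition integ a b g : R := \int[mu]_(t in `[a, b]) g t.

Lemma integD a b g h : continuous g -> continuous h ->
  integ a b (fun t => g t + h t) = integ a b g + integ a b h.
Proof. by move=> cg ch; apply: RintegralD => //; exact: cont_integrable. Qed.

Lemma integZ a b k g : continuous g ->
  integ a b (fun t => k * g t) = k * integ a b g.
Proof. by move=> cg; apply: RintegralZl => //; exact: cont_integrable. Qed.

Lemma le_integ a b g h : continuous g -> continuous h ->
  (forall t, a <= t <= b -> g t <= h t) -> integ a b g <= integ a b h.
Proof.
move=> cg ch gh; apply: le_Rintegral => [//|||t /=].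
- exact: cont_integrable.
- exact: cont_integrable.
- by rewrite in_itv /=; exact: gh.
Qed.

Lemma eq_integ a b g h : (forall t, a <= t <= b -> g t = h t) ->
  integ a b g = integ a b h.
Proof.
by move=> gh; apply: eq_Rintegral => t; rewrite inE /= in_itv /=; exact: gh.
Qed.

Lemma integ_cst a b k : a <= b -> integ a b (fun=> k) = k * (b - a).
Proof.
move=> ab; rewrite /integ Rintegral_cst//= lebesgue_measure_itv/= lte_fin.
by case: ltP => [//|ba]; rewrite (@le_anti _ _ a b) ?ab ?ba//= subrr.
Qed.

Lemma FTC1_integ a x g : a < x -> continuous g ->
  is_derive x 1 (fun u => integ a u g) (g x).
Proof.
move=> ax cg; have x1 : x < x + 1 by rewrite ltrDl.
have [] := @continuous_FTC1_closed R g a x _ x1 _ ax (cg x).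
  exact: cont_integrable.
by move=> d1 d2; split => //; rewrite -derive1E.
Qed.

Lemma FTC2_integ a b f g : a <= b -> continuous g ->
  (forall x, a <= x <= b -> is_derive x 1 f (g x)) -> integ a b g = f b - f a.
Proof.
move=> ab cg dF; have cf x : a <= x <= b -> {for x, continuous f}.
  by move/dF => [d1 _]; apply: differentiable_continuous; apply/derivable1_diffP.
move: ab; rewrite le_eqVlt => /orP[/eqP ab|ab].
  by rewrite /integ -ab set_itv1 Rintegral_set1 subrr.
rewrite /integ /Rintegral (@continuous_FTC2 R g f)//.
- exact: continuous_subspaceT.
- split.
  + move=> x; rewrite in_itv/= => /andP[/ltW x1 /ltW x2].
    by have [] : is_derive x 1 f (g x) by apply: dF; rewrite x1.
  + by apply: cvg_at_right_filter; apply: cf; rewrite lexx ltW.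
  + by apply: cvg_at_left_filter; apply: cf; rewrite lexx ltW.
- move=> x; rewrite in_itv/= => /andP[/ltW x1 /ltW x2].
  have [_] : is_derive x 1 f (g x) by apply: dF; rewrite x1.
  by rewrite -derive1E.
Qed.

(** An open set of the plane is a countable union of rectangles with rational
    corners; this is what connects the product topology with the product
    sigma-algebra. *)
Lemma open_prod_measurable (U : set (R * R)) : open U -> measurable U.
Proof.
move=> oU.
pose D (q : (rat * rat) * (rat * rat)) : set (R * R) :=
  `]ratr q.1.1, ratr q.1.2[ `*` `]ratr q.2.1, ratr q.2.2[.
have -> : U = \bigcup_q (if `[< D q `<=` U >] then D q else set0).
  apply/seteqP; split => [[x y] Uxy|z [q _]]; last first.
    by case: asboolP => // DU; exact: DU.
  have [[A B] /= [Ax By] AB] : nbhs (x, y) U by exact: open_nbhs_nbhs.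
  have box (z : R) (C : set R) : nbhs z C -> exists q : rat * rat,
      [/\ ratr q.1 < z, z < ratr q.2 & `]ratr q.1, ratr q.2[ `<=` C].
    move=> /nbhs_ballP[e /= e0 eC].
    have [q1] := @rat_in_itvoo R (z - e) z ltac:(by rewrite ltrBlDr ltrDl).
    have [q2] := @rat_in_itvoo R z (z + e) ltac:(by rewrite ltrDl).
    rewrite !in_itv/= => /andP[zq2 q2z] /andP[q1z zq1].
    exists (q1, q2); split => // t /=; rewrite in_itv/= => /andP[t1 t2].
    apply: eC; rewrite /ball/= ltr_distlC; apply/andP; split.
      exact: lt_trans t1.
    exact: lt_trans q2z.
  have [q1 [q1a q1b q1A]] := box _ _ Ax.
  have [q2 [q2a q2b q2B]] := box _ _ By.
  exists (q1, q2) => //; case: asboolP => [_|].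
    by split; rewrite /= in_itv/= ?q1a ?q2a.
  by case=> -[s t] [/= sA tB]; apply: AB; split; [exact: q1A|exact: q2B].
apply: countable_bigcupT_measurable; first exact: countableP.
move=> q; case: ifP => _ //; apply: measurableX; exact: measurable_itv.
Qed.

Lemma continuous_prod_measurable (g : R * R -> R) :
  continuous g -> measurable_fun setT g.
Proof.
move=> /continuousP cg; apply: (measurability _ (measurable_realfun.RGenOpens.measurableE R)).
move=> _ [_ [a [b ->] <-]]; rewrite setTI; apply: open_prod_measurable.
exact/cg/interval_open.
Qed.

Lemma continuous_pair (T U W : topologicalType) (f : T -> U) (g : T -> W) :
  continuous f -> continuous g -> continuous (fun x => (f x, g x)).
Proof. by move=> cf cg x; apply: cvg_pair; [exact: cf|exact: cg]. Qed.

(** Compactness of [a, b] turns continuity at the points (x, t) into a bound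
    uniform in t. *)
Lemma integ_continuous (T : topologicalType) (g : T * R -> R) a b : a <= b ->
  continuous g -> continuous (fun x => integ a b (fun t => g (x, t))).
Proof.
move=> ab cg x; apply/cvgrPdist_le => /= e e0.
pose k := e / (b - a + 1).
have ba1 : 0 < b - a + 1 by rewrite ltr_wpDl// subr_ge0.
have k0 : 0 < k by rewrite divr_gt0.
have cgx y : continuous (fun t => g (y, t)).
  move=> t; apply: (@continuous_comp _ _ _ (fun t => (y, t)) g); last exact: cg.
  by apply: continuous_pair => ?; [exact: cvg_cst|exact: cvg_id].
have key t : `[a, b]%classic t ->
    \forall s \near t & y \near x, `|g (x, s) - g (y, s)| <= k.
  move=> tab; have k20 : 0 < k / 2 by rewrite divr_gt0.
  have /cvgrPdist_le /(_ _ k20)[[P1 P2] /= [P1x P2t] P12] := cg (x, t).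
  have Q : \forall s \near t, `|g (x, t) - g (x, s)| <= k / 2.
    by have /cvgrPdist_le /(_ _ k20) := cgx x t.
  exists (P2 `&` [set s | `|g (x, t) - g (x, s)| <= k / 2], P1).
    by split => //=; exact: filterI.
  move=> [s y] /= [[P2s sQ] P1y].
  have : `|g (x, t) - g (y, s)| <= k / 2 by exact: (P12 (y, s)).
  by move: sQ; rewrite !ler_norml => /andP[? ?] /andP[? ?]; lra.
have /compact_near_coveringP/(_ T (nbhs x)
  (fun y t => `|g (x, t) - g (y, t)| <= k) _ key) := @segment_compact R a b.
apply: filterS => y gxy.
have cB : continuous (fun t => g (x, t) + -1 * g (y, t)).
  by move=> t; apply: cvgD; [exact: cgx|apply: cvgMr; exact: cgx].
have cN : continuous (fun t => -1 * g (y, t)).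
  by move=> t; apply: cvgMr; exact: cgx.
have -> : integ a b (fun t => g (x, t)) - integ a b (fun t => g (y, t)) =
          integ a b (fun t => g (x, t) + -1 * g (y, t)).
  by rewrite integD ?integZ ?mulN1r//; exact: cgx.
have gk t : a <= t <= b -> `|g (x, t) + -1 * g (y, t)| <= k.
  by move=> tab; rewrite mulN1r; apply: gxy; rewrite /= in_itv.
have kba : k * (b - a) <= e.
  rewrite /k mulrAC ler_pdivrMr// ler_pM2l//; lra.
rewrite ler_norml; apply/andP; split.
  apply: (@le_trans _ _ (integ a b (fun=> - k))).
    by rewrite integ_cst// mulNr lerN2.
  apply: le_integ => //; first by move=> ?; exact: cvg_cst.
  by move=> t /gk; rewrite ler_norml => /andP[].
apply: (@le_trans _ _ (integ a b (fun=> k))); last by rewrite integ_cst.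
apply: le_integ => //; first by move=> ?; exact: cvg_cst.
by move=> t /gk; rewrite ler_norml => /andP[].
Qed.

Section rectangle.
Variables (g : R * R -> R) (a b c d : R).
Hypothesis cg : continuous g.

Let box := `[a, b]%classic `*` `[c, d]%classic.

Let mbox : measurable box.
Proof. by apply: measurableX; exact: measurable_itv. Qed.

Let gbox_int : (mu \x mu)%E.-integrable setT ((EFin \o g) \_ box).
Proof.
have cb : compact box by apply: compact_setX; exact: segment_compact.
rewrite -integrable_mkcond//; apply: measurable_bounded_integrable => //.
- rewrite /= product_measure1E//= !lebesgue_measure_itv/=.
  by do 2 case: ifP => _; rewrite ?mule0 ?mul0e// -!EFinB -EFinM ltry.
- by apply: measurable_funTS; exact: continuous_prod_measurable.
- have /compact_bounded[M [_ mrt]] := continuous_compact (continuous_subspaceT cg) cb.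
  by exists M; split; rewrite ?num_real // => ? ? ? ?; exact: mrt.
Qed.

Let patch_eq (s t : R) : ((EFin \o g) \_ box) (s, t) =
  if s \in `[a, b] then ((fun t => (g (s, t))%:E) \_ `[c, d]) t else 0%E.
Proof.
rewrite /patch /box in_setX /= !mem_setE.
by case: (s \in _) => //; case: (t \in _).
Qed.

(** The two orders of integration are both the integral over the rectangle for
    the product measure, which is the form in which fluxes through half-planes
    are given. *)
Lemma integ_rect :
  \int[(mu \x mu)%E]_(z in box) g z =
  integ a b (fun s => integ c d (fun t => g (s, t))).
Proof.
rewrite {1}/Rintegral integral_mkcond -integral12_prod_meas1//.
rewrite /integ {1}/Rintegral [in RHS]integral_mkcond; congr fine.
apply: eq_integral => s _; rewrite [RHS]/patch mem_setE /fubini_F.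
transitivity (\int[mu]_t (if s \in `[a, b]
    then ((fun t => (g (s, t))%:E) \_ `[c, d]) t else 0))%E.
  by apply: eq_integral => t _; exact: patch_eq.
case: ifPn => sab; last by rewrite integral0.
rewrite -integral_mkcond /Rintegral fineK//.
apply: integrable_fin_num => //; apply: cont_integrable => t.
apply: (@continuous_comp _ _ _ (fun t => (s, t)) g); last exact: cg.
by apply: continuous_pair => ?; [exact: cvg_cst|exact: cvg_id].
Qed.

Lemma integ_rect_swap :
  \int[(mu \x mu)%E]_(z in box) g z =
  integ c d (fun t => integ a b (fun s => g (s, t))).
Proof.
rewrite {1}/Rintegral integral_mkcond -integral21_prod_meas1//.
rewrite /integ {1}/Rintegral [in RHS]integral_mkcond; congr fine.
apply: eq_integral => t _; rewrite [RHS]/patch mem_setE /fubini_G.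
have [tcd|tcd] := ifPn; last first.
  rewrite integral0_eq// => s _; rewrite patch_eq /patch mem_setE.
  by rewrite (negbTE tcd) if_same.
rewrite /Rintegral fineK; last first.
  apply: integrable_fin_num => //; apply: cont_integrable => s.
  apply: (@continuous_comp _ _ _ (fun s => (s, t)) g); last exact: cg.
  by apply: continuous_pair => ?; [exact: cvg_id|exact: cvg_cst].
rewrite [RHS]integral_mkcond; apply: eq_integral => s _.
by rewrite patch_eq /patch !mem_setE tcd.
Qed.

End rectangle.

Lemma integ_swap (g : R * R -> R) a b c d :
  continuous g ->
  integ a b (fun s => integ c d (fun t => g (s, t))) =
  integ c d (fun t => integ a b (fun s => g (s, t))).
Proof. by move=> cg; rewrite -integ_rect// integ_rect_swap. Qed.

End OneDim.

Section Positivity.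
Variable R : realType.
Implicit Types (g : R -> R) (a b c : R).

Lemma integ_ge0 a b g : (forall t, 0 <= g t) -> 0 <= integ a b g.
Proof. by move=> g0; apply: Rintegral_ge0 => t _. Qed.

Lemma integ_split a b c g : continuous g -> a <= c <= b ->
  integ a b g = integ a c g + integ c b g.
Proof.
move=> cg /andP[ac cb].
have := @Rintegral_itvB R g (BLeft a) (BRight b) c (@cont_integrable R g a b cg).
rewrite !bnd_simp => /(_ ac cb) /eqP; rewrite subr_eq /integ => /eqP ->.
rewrite addrC; congr (_ + _); rewrite Rintegral_itv_obnd_cbnd//.
apply: integrableS (@cont_integrable R g a b cg) => //.
by apply: subset_itvr; rewrite bnd_simp.
Qed.

Lemma integ_gt0 a b g t0 : continuous g -> (forall t, 0 <= g t) ->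
  a < t0 < b -> 0 < g t0 -> 0 < integ a b g.
Proof.
move=> cg g0 /andP[at0 t0b] gt0; have g20 : 0 < g t0 / 2 by rewrite divr_gt0.
have /cvgrPdist_le /(_ _ g20)/nbhs_ballP[e /= e0 eg] := cg t0.
pose r := Num.min (e / 2) (Num.min (t0 - a) (b - t0)).
have r0 : 0 < r by rewrite !lt_min divr_gt0//= !subr_gt0 at0.
have [re ra rb] : [/\ r <= e / 2, r <= t0 - a & r <= b - t0].
  by split; rewrite /r !ge_min lexx ?orbT.
rewrite (integ_split (c := t0 - r))//; last by apply/andP; split; lra.
rewrite (integ_split (a := t0 - r) (c := t0 + r))//; last by apply/andP; split; lra.
rewrite ltr_wpDl ?integ_ge0// ltr_pwDl ?integ_ge0//.
apply: (@lt_le_trans _ _ (integ (t0 - r) (t0 + r) (fun=> g t0 / 2))).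
  by rewrite integ_cst ?mulr_gt0//; lra.
apply: le_integ => // [t|t /andP[t1 t2]]; first exact: cvg_cst.
have : `|g t0 - g t| <= g t0 / 2.
  by apply: eg; rewrite /ball/= ltr_distlC; apply/andP; split; lra.
by rewrite ler_norml => /andP[]; lra.
Qed.

Lemma integ0 a b : integ a b (fun=> 0 : R) = 0.
Proof. by rewrite /integ /Rintegral integral0. Qed.

Lemma integ_shift (g : R -> R) (a b s : R) : continuous g -> a <= b ->
  integ a b (fun t => g (t + s)) = integ (a + s) (b + s) g.
Proof.
move=> cg ab; pose P u := integ (a + s - 1) u g.
have DP (u : R) : a + s - 1 < u -> is_derive u 1 P (g u).
  by move=> s1; exact: FTC1_integ.
have -> : integ (a + s) (b + s) g = P (b + s) - P (a + s).
  apply: FTC2_integ => //; first by rewrite lerD2r.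
  by move=> u /andP[au _]; apply: DP; lra.
apply: (FTC2_integ (f := fun u => P (u + s))) => //.
  move=> t; apply: (@continuous_comp _ _ _ (fun t => t + s) g); last exact: cg.
  by apply: cvgD; [exact: cvg_id|exact: cvg_cst].
move=> t /andP[ta _]; rewrite -[g _]mulr1; apply: is_derive1_comp.
  by apply: DP; lra.
by rewrite -[X in is_derive _ _ _ X]addr0; apply: is_deriveD.
Qed.

End Positivity.

(** * Integrals along segments and directional derivatives *)

Section Segment.
Variables (R : realType) (V : normedModType R).
Implicit Types (f g : V -> R) (x d e : V) (a b : R).

Lemma near0_lt1 : \forall h \near (0 : R), `|h| < 1.
Proof. exact: nbhs0_lt. Qed.

(** All integrals below are iterations of this operator: it acts on continuous
    functions, operators in different directions commute, and in its own
    direction it inverts differentiation. *)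
Definition seg d a b f x : R := integ a b (fun t => f (x + t *: d)).

Lemma continuous_line2 d f : continuous f ->
  continuous (fun p : V * R => f (p.1 + p.2 *: d)).
Proof.
move=> cf p; apply: (@continuous_comp _ _ _ (fun p : V * R => p.1 + p.2 *: d)).
  apply: cvgD; first exact: cvg_fst.
  by apply: cvgZr_tmp; exact: cvg_snd.
exact: cf.
Qed.

Lemma continuous_line d f x : continuous f ->
  continuous (fun t : R => f (x + t *: d)).
Proof.
move=> cf t.
apply: (@continuous_comp _ _ _ (fun t : R => (x, t))
  (fun p : V * R => f (p.1 + p.2 *: d))); last exact: continuous_line2.
by apply: continuous_pair => ?; [exact: cvg_cst|exact: cvg_id].
Qed.

Lemma seg_continuous d a b f : a <= b -> continuous f -> continuous (seg d a b f).
Proof.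
move=> ab cf; have := integ_continuous ab (@continuous_line2 d f cf).
by rewrite /seg.
Qed.

Lemma segD d a b f g x : continuous f -> continuous g ->
  seg d a b (fun y => f y + g y) x = seg d a b f x + seg d a b g x.
Proof. by move=> cf cg; apply: integD; exact: continuous_line. Qed.

Lemma segZ d a b k f x : continuous f ->
  seg d a b (fun y => k * f y) x = k * seg d a b f x.
Proof. by move=> cf; apply: integZ; exact: continuous_line. Qed.

Lemma eq_seg d a b f g x :
  (forall t, a <= t <= b -> f (x + t *: d) = g (x + t *: d)) ->
  seg d a b f x = seg d a b g x.
Proof. by move=> fg; exact: eq_integ. Qed.

Lemma seg_comm d e a b a' b' f x : continuous f ->
  seg d a b (seg e a' b' f) x = seg e a' b' (seg d a b f) x.
Proof.
move=> cf.
have c2 : continuous (fun p : R * R => f (x + p.1 *: d + p.2 *: e)).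
  move=> p; apply: (@continuous_comp _ _ _
    (fun p : R * R => x + p.1 *: d + p.2 *: e)); last exact: cf.
  apply: cvgD; [apply: cvgD; first exact: cvg_cst|].
    by apply: cvgZr_tmp; exact: cvg_fst.
  by apply: cvgZr_tmp; exact: cvg_snd.
rewrite /seg; apply: etrans (integ_swap a b a' b' c2) _; apply: eq_integ => t _.
by apply: eq_integ => s _; rewrite addrAC.
Qed.

(** Reduces directional derivatives to derivatives of functions of one real
    variable. *)
Lemma is_derive_line d f x t df :
  is_derive (x + t *: d) d f df <->
  is_derive t 1 (fun s : R => f (x + s *: d)) df.
Proof.
have Ed : derivable f (x + t *: d) d = derivable (fun s : R => f (x + s *: d)) t 1.
  rewrite /derivable; set g1 := fun h => h^-1 *: _; set g2 := fun h => h^-1 *: _.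
  suff -> : g1 = g2 by [].
  apply/funext => h; rewrite /g1 /g2 /=; congr (_ *: (f _ - _)).
  by rewrite [h%:A]mulr1 scalerDl addrCA addrA addrC.
have ED : 'D_d f (x + t *: d) = 'D_1 (fun s : R => f (x + s *: d)) t.
  rewrite /derive; set g1 := fun h => h^-1 *: _; set g2 := fun h => h^-1 *: _.
  suff -> : g1 = g2 by [].
  apply/funext => h; rewrite /g1 /g2 /=; congr (_ *: (f _ - _)).
  by rewrite [h%:A]mulr1 scalerDl addrCA addrA addrC.
by split => -[D1 D2]; split; rewrite ?Ed ?ED// -?Ed// -?ED.
Qed.

(** The derivative is named explicitly, so that equations between derivatives
    can be composed without computing them. *)
Record Cdir d f g : Prop := MkCdir {
  Cdir_cont : continuous f;
  Cdir_cont_deriv : continuous g;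
  Cdir_is_derive : forall x, is_derive x d f (g x) }.

Lemma Cdir_line d f g x t : Cdir d f g ->
  is_derive (t : R) 1 (fun s : R => f (x + s *: d)) (g (x + t *: d)).
Proof. by case=> _ _ D; apply/is_derive_line. Qed.

Lemma seg_Cdir d a b f g x : Cdir d f g -> a <= b ->
  seg d a b g x = f (x + b *: d) - f (x + a *: d).
Proof.
move=> C ab; apply: (FTC2_integ (f := fun s : R => f (x + s *: d))) => //.
  by apply: continuous_line; case: C.
by move=> t _; exact: Cdir_line.
Qed.

(** The converse of [seg_Cdir]; it produces derivatives from identities between
    integrals, without any limit argument. *)
Lemma Cdir_of_seg d f g : continuous f -> continuous g ->
  (forall x (h : R), -1 < h < 1 -> f (x + h *: d) - f (x - d) = seg d (-1) h g x) ->
  Cdir d f g.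
Proof.
move=> cf cg fg; split => // x.
rewrite -{1}(addr0 x) -(scale0r d); apply/is_derive_line.
have D : is_derive (0 : R) 1 (fun u => integ (-1) u (fun t => g (x + t *: d)))
    (g (x + 0 *: d)).
  apply: (@FTC1_integ R (-1) 0 (fun t => g (x + t *: d))).
    by rewrite ltrN10.
  exact: continuous_line.
rewrite scale0r addr0 in D.
have D2 : is_derive (0 : R) 1 (fun u => integ (-1) u (fun t => g (x + t *: d))
   + f (x - d)) (g x).
  by rewrite -[g x]addr0; apply: is_deriveD.
apply: near_eq_is_derive D2; near=> h; apply/eqP; rewrite eq_sym -subr_eq.
apply/eqP/fg; rewrite -ltr_norml.
by near: h; exact: near0_lt1.
Unshelve. all: by end_near. Qed.

(** Differentiation under the integral sign: write f as an integral along d and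
    exchange the two integrals. *)
Lemma Cdir_seg_under d e a b f g : Cdir d f g -> a <= b ->
  Cdir d (seg e a b f) (seg e a b g).
Proof.
move=> C ab; have [cf cg _] := C.
apply: Cdir_of_seg; [exact: seg_continuous|exact: seg_continuous|].
move=> x h /andP[h1 _]; rewrite -seg_comm//.
have cfh : continuous (fun t : R => f (x + h *: d + t *: e)) by exact: continuous_line.
have cfd : continuous (fun t : R => f (x - d + t *: e)) by exact: continuous_line.
have -> : seg e a b (seg d (-1) h g) x =
    integ a b (fun t => f (x + h *: d + t *: e) + -1 * f (x - d + t *: e)).
  apply: eq_integ => t _; rewrite (seg_Cdir _ C) ?ltW// mulN1r.
  by rewrite scaleN1r -!(addrAC _ (t *: e)).
by rewrite integD ?integZ ?mulN1r// => t; apply: cvgMr; exact: cfd.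
Qed.

Lemma Cdir_seg d a b g : continuous g -> a <= b ->
  Cdir d (seg d a b g) (fun x => g (x + b *: d) - g (x + a *: d)).
Proof.
move=> cg ab; have cs (s : R) : continuous (fun x => g (x + s *: d)).
  move=> x; apply: (@continuous_comp _ _ _ (fun x => x + s *: d) g).
    by apply: cvgD; [exact: cvg_id|exact: cvg_cst].
  exact: cg.
split; [exact: seg_continuous|by move=> x; apply: cvgB; exact: cs|].
move=> x; rewrite -[X in is_derive X](addr0 x) -(scale0r d); apply/is_derive_line.
pose P s := integ (a - 1) s (fun t : R => g (x + t *: d)).
have cx : continuous (fun t : R => g (x + t *: d)) by exact: continuous_line.
have DP (s : R) : a - 1 < s -> is_derive s 1 P (g (x + s *: d)).
  by move=> s1; exact: FTC1_integ.
have DPs (s u : R) : a - 1 < u + s -> is_derive u 1 (fun v => P (v + s)) (g (x + (u + s) *: d)).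
  move=> us; rewrite -[g _]mulr1; apply: is_derive1_comp; first exact: DP.
  by rewrite -[X in is_derive _ _ _ X]addr0; apply: is_deriveD.
have D2 : is_derive (0 : R) 1 (fun u => P (u + b) - P (u + a))
    (g (x + b *: d) - g (x + a *: d)).
  rewrite -{2}(add0r b) -{2}(add0r a).
  by apply: is_deriveB; apply: DPs; rewrite add0r; lra.
apply: near_eq_is_derive D2; near=> h; rewrite /seg !(addrC h); symmetry.
apply: (FTC2_integ (f := fun s => P (s + h)) ab).
  exact: continuous_line.
move=> t /andP[ta _]; rewrite -addrA -scalerDl (addrC h); apply: DPs.
suff : -1 < h by lra.
suff : `|h| < 1 by rewrite ltr_norml => /andP[].
by near: h; exact: near0_lt1.
Unshelve. all: by end_near. Qed.

Lemma is_derive_slope d f x (K : R -> R) : {for 0, continuous K} ->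
  (forall h, f (x + h *: d) - f x = h * K h) -> is_derive x d f (K 0).
Proof.
move=> cK fK; suff L : (fun h : R => h^-1 *: ((f \o shift x) (h *: d) - f x)) h @[h --> 0^'] --> K 0.
  by split; [apply/cvg_ex; exists (K 0)|exact: cvg_lim].
apply: (@cvg_trans _ (K @ 0^')).
  apply: near_eq_cvg; near=> h.
  have h0 : h != 0 by near: h; exact: nbhs_dnbhs_neq.
  by rewrite /= (addrC _ x) fK scalerA mulVf// scale1r.
by apply: cvg_trans cK; apply: cvg_app; exact: cvg_within.
Unshelve. all: by end_near. Qed.

Lemma Cdir_scale d f g k : Cdir d f g -> Cdir (k *: d) f (fun x => k * g x).
Proof.
move=> C; have [cf cg _] := C; split => //.
  by move=> x; apply: cvgMr; exact: cg.
move=> x; rewrite -[X in is_derive X](addr0 x) -(scale0r (k *: d)); apply/is_derive_line.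
have -> : (fun s : R => f (x + s *: (k *: d))) =
    (fun s => f (x + s *: d)) \o (fun s => s * k).
  by apply/funext => s; rewrite /= scalerA.
rewrite (mulrC k); apply: is_derive1_comp.
  by have := Cdir_line x 0 C; rewrite scale0r addr0 mul0r.
have := is_deriveZ k (is_derive_id (0 : R) 1).
by rewrite [X in is_derive _ _ X](_ : _ = (fun s => s * k)) ?[X in is_derive _ _ _ X]mulr1//;
  apply/funext => s /=; rewrite mulrC.
Qed.

Lemma Cdir_slope d f g y u : Cdir d f g ->
  f (y + u *: d) - f y = u * integ 0 1 (fun s => g (y + (s * u) *: d)).
Proof.
move=> C; have := seg_Cdir y (Cdir_scale u C) ler01.
rewrite scale1r scale0r addr0 => <-; rewrite -integZ; last first.
  under eq_fun do rewrite -scalerA.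
  by apply: continuous_line; case: C.
by apply: eq_integ => s _; rewrite scalerA.
Qed.

(** The derivative is additive in the direction because both partial derivatives
    are continuous: the increment along d + e is the sum of an increment along d
    from a moving point and one along e. *)
Lemma Cdir_addv d e f g h : Cdir d f g -> Cdir e f h ->
  Cdir (d + e) f (fun x => g x + h x).
Proof.
move=> Cd Ce; have [cf cg _] := Cd; have [_ ch _] := Ce; split => //.
  by move=> x; apply: cvgD; [exact: cg|exact: ch].
move=> x; pose K (u : R) := integ 0 1 (fun s => g (x + u *: e + (s * u) *: d))
   + integ 0 1 (fun s => h (x + (s * u) *: e)).
have -> : g x + h x = K 0.
  rewrite /K; under eq_integ do rewrite mulr0 !scale0r !addr0.
  under [X in _ = _ + X]eq_integ do rewrite mulr0 !scale0r !addr0.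
  by rewrite !integ_cst// subr0 !mulr1.
have cK1 : continuous (fun p : R * R => g (x + p.1 *: e + (p.2 * p.1) *: d)).
  move=> p; apply: (@continuous_comp _ _ _
    (fun p : R * R => x + p.1 *: e + (p.2 * p.1) *: d)); last exact: cg.
  apply: cvgD; [apply: cvgD; first exact: cvg_cst|].
    by apply: cvgZr_tmp; exact: cvg_fst.
  by apply: cvgZr_tmp; apply: cvgM; [exact: cvg_snd|exact: cvg_fst].
have cK2 : continuous (fun p : R * R => h (x + (p.2 * p.1) *: e)).
  move=> p; apply: (@continuous_comp _ _ _
    (fun p : R * R => x + (p.2 * p.1) *: e)); last exact: ch.
  apply: cvgD; first exact: cvg_cst.
  by apply: cvgZr_tmp; apply: cvgM; [exact: cvg_snd|exact: cvg_fst].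
apply: is_derive_slope => [|u].
  by apply: cvgD; [apply: (integ_continuous _ cK1)|apply: (integ_continuous _ cK2)].
rewrite /K mulrDr -(Cdir_slope _ _ Cd) -(Cdir_slope _ _ Ce) scalerDr.
by rewrite subrKA [in RHS]addrAC -[in RHS]addrA.
Qed.

Lemma CdirD d f g f' g' : Cdir d f g -> Cdir d f' g' ->
  Cdir d (fun x => f x + f' x) (fun x => g x + g' x).
Proof.
move=> [cf cg D] [cf' cg' D']; split => x.
- by apply: cvgD; [exact: cf|exact: cf'].
- by apply: cvgD; [exact: cg|exact: cg'].
- exact: is_deriveD.
Qed.

Lemma CdirM d f g f' g' : Cdir d f g -> Cdir d f' g' ->
  Cdir d (fun x => f x * f' x) (fun x => f x * g' x + f' x * g x).
Proof.
move=> [cf cg D] [cf' cg' D']; split => x.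
- by apply: cvgM; [exact: cf|exact: cf'].
- by apply: cvgD; apply: cvgM; [exact: cf|exact: cg'|exact: cf'|exact: cg].
- exact: is_deriveM.
Qed.

Lemma Cdir_cst d k : Cdir d (fun=> k) (fun=> 0).
Proof. by split => x; [exact: cvg_cst|exact: cvg_cst|exact: is_derive_cst]. Qed.

Lemma CdirZ d k f g : Cdir d f g -> Cdir d (fun x => k * f x) (fun x => k * g x).
Proof.
move=> [cf cg D]; split => x; [by apply: cvgMr; exact: cf|by apply: cvgMr; exact: cg|].
exact: is_deriveZ.
Qed.

End Segment.

(** * Coordinates, supports and half-planes *)

Section Space.
Variable R : realType.
Local Notation E3 := 'rV[R]_3.
Implicit Types (f g : E3 -> R) (x d e : E3).

Definition i0 : 'I_3 := ord0.
Definition i1 : 'I_3 := lift ord0 ord0.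
Definition i2 : 'I_3 := lift ord0 (lift ord0 ord0).

Lemma sum3 (V : nmodType) (F : 'I_3 -> V) : \sum_i F i = F i0 + F i1 + F i2.
Proof. by rewrite !big_ord_recl big_ord0 addr0 addrA. Qed.

Lemma ord3P (P : 'I_3 -> Prop) : P i0 -> P i1 -> P i2 -> forall i, P i.
Proof.
move=> P0 P1 P2 [[|[|[|//]]] Hi].
- by have -> : Ordinal Hi = i0 by exact: val_inj.
- by have -> : Ordinal Hi = i1 by exact: val_inj.
- by have -> : Ordinal Hi = i2 by exact: val_inj.
Qed.

Definition delta (i : 'I_3) : E3 := delta_mx ord0 i.

Lemma deltaE i j : delta i ord0 j = (i == j)%:R.
Proof. by rewrite /delta mxE eqxx /= eq_sym. Qed.

Lemma dot3 x y : dot x y =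
  x ord0 i0 * y ord0 i0 + x ord0 i1 * y ord0 i1 + x ord0 i2 * y ord0 i2.
Proof. by rewrite /dot sum3. Qed.

Lemma dotC x y : dot x y = dot y x.
Proof. by rewrite !dot3; ring. Qed.

Lemma dotDr x y z : dot x (y + z) = dot x y + dot x z.
Proof. by rewrite !dot3 !mxE; ring. Qed.

Lemma dotZr x k y : dot x (k *: y) = k * dot x y.
Proof. by rewrite !dot3 !mxE; ring. Qed.

Lemma dotDl x y z : dot (y + z) x = dot y x + dot z x.
Proof. by rewrite !dot3 !mxE; ring. Qed.

Lemma dotZl x k y : dot (k *: y) x = k * dot y x.
Proof. by rewrite !dot3 !mxE; ring. Qed.

Lemma dot_delta i x : dot (delta i) x = x ord0 i.
Proof.
rewrite dot3 !deltaE; move: i; apply: ord3P => /=;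
  by rewrite !(mul0r, mul1r, addr0, add0r).
Qed.

Lemma delta_unit i : dot (delta i) (delta i) = 1.
Proof. by rewrite dot_delta deltaE eqxx. Qed.

Lemma row_delta x : x = x ord0 i0 *: delta i0 + x ord0 i1 *: delta i1
   + x ord0 i2 *: delta i2.
Proof.
apply/rowP; apply: ord3P; rewrite !mxE /=;
  by rewrite !(mulr0, mulr1, addr0, add0r).
Qed.

Lemma dot_continuous d : continuous (dot d).
Proof.
have c i : continuous (fun x : E3 => d ord0 i * x ord0 i).
  by move=> x; exact: (cvgMl_tmp (@coord_continuous R 1 3 ord0 i x)).
have -> : dot d = (fun x : E3 => d ord0 i0 * x ord0 i0 + d ord0 i1 * x ord0 i1
    + d ord0 i2 * x ord0 i2) by apply/funext => x; rewrite dot3.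
by move=> x; apply: cvgD (c i2 x); exact: cvgD (c i0 x) (c i1 x).
Qed.

(** Bounding the coordinate along every unit vector, rather than along the axes,
    gives the same bound in all orthonormal frames. *)
Definition supp (K : R) f := forall x d, dot d d = 1 -> K < `|dot d x| -> f x = 0.

Lemma supp_coord K f x i : supp K f -> K < `|x ord0 i| -> f x = 0.
Proof. by move=> s; rewrite -dot_delta; apply: s; exact: delta_unit. Qed.

Lemma unit_coord d i : dot d d = 1 -> `|d ord0 i| <= 1.
Proof.
rewrite dot3 => d1; rewrite -(@ler_pXn2r _ 2%N)// ?nnegrE// expr1n real_normK ?num_real//.
move: i; apply: ord3P; rewrite -d1;
  have := sqr_ge0 (d ord0 i0); have := sqr_ge0 (d ord0 i1);
  have := sqr_ge0 (d ord0 i2); rewrite !expr2; lra.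
Qed.

Lemma dot_le x d M : dot d d = 1 -> (forall i, `|x ord0 i| <= M) -> `|dot d x| <= 3 * M.
Proof.
move=> /unit_coord d1 xM; have M0 : 0 <= M by exact: le_trans (xM i0).
have dx i : `|d ord0 i * x ord0 i| <= M.
  by rewrite normrM -[M]mul1r ler_pM.
rewrite dot3; apply: le_trans (ler_normD _ _) _.
have := ler_normD (d ord0 i0 * x ord0 i0) (d ord0 i1 * x ord0 i1).
have := dx i0; have := dx i1; have := dx i2; lra.
Qed.

Lemma compact_supp f : compactly_supported f -> exists2 K, 0 < K & supp K f.
Proof.
move=> /compact_bounded[M [_ HM]]; pose M' : R := `|M| + 1.
have MM' : M < M' by rewrite /M' ltr_pwDr// ler_norm.
have M'0 : 0 < M' by rewrite /M' ltr_wpDl.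
exists (3 * M'); first by rewrite mulr_gt0.
move=> x d d1; apply: contraPeq => fx.
apply/negP; rewrite -leNgt; apply: dot_le => // i.
have xM : `|x| <= M' by apply: (HM _ MM'); exact: subset_closure.
by apply: le_trans xM; rewrite [leRHS]mx_normrE; apply/bigmax_geP; right; exists (ord0, i).
Qed.

(** The hypothesis says that the integrand vanishes on the half-plane outside
    the rectangle of sides 2 L and T. *)
Lemma half_plane_seg (m : oriented_line R) (h : half_plane m) f (L T : R) :
  continuous f -> 0 <= L -> 0 <= T ->
  (forall s t : R, 0 <= t -> L < `|s| \/ T < t ->
     f (base_point m + t *: inward h + s *: direction m) = 0) ->
  half_plane_integral h f =
  seg (inward h) 0 T (seg (direction m) (- L) L f) (base_point m).
Proof.
move=> cf L0 T0 f0; rewrite /half_plane_integral.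
have cg : continuous (fun z : R * R => f (half_plane_point h z)).
  move=> p; apply: (@continuous_comp _ _ _ (half_plane_point h)); last exact: cf.
  apply: cvgD; [apply: cvgD; first exact: cvg_cst|].
    by apply: cvgZr_tmp; exact: cvg_fst.
  by apply: cvgZr_tmp; exact: cvg_snd.
have LL : - L <= L by lra.
transitivity (\int[(lebesgue_measure \x lebesgue_measure)%E]_(z in
    `[- L, L]%classic `*` `[0, T]%classic) f (half_plane_point h z)); last first.
  rewrite (integ_rect_swap (- L) L 0 T cg); apply: eq_integ => t _; apply: eq_integ => s _.
  by rewrite /half_plane_point/= addrAC.
rewrite [LHS]Rintegral_mkcond [RHS]Rintegral_mkcond; apply: eq_Rintegral => -[s t] _.
rewrite /patch; case: ifPn => [/set_mem/= t0|tn].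
  case: ifPn => // stn; rewrite /half_plane_point/= addrAC; apply: f0 => //.
  case: (ltP L `|s|) => [|sL]; [by left|right].
  rewrite ltNge; apply: contraNN stn => tT; apply/mem_set; split => /=.
    by rewrite in_itv/= -ler_norml.
  by rewrite in_itv/= t0.
case: ifPn => // /set_mem/= [_]; rewrite in_itv/= => /andP[t0 _].
by move: tn; rewrite mem_set.
Qed.

End Space.

(** * Integrals over a cube *)

Section Cube.
Variable R : realType.
Local Notation E3 := 'rV[R]_3.
Implicit Types (f g : E3 -> R) (x d e y : E3).

Lemma seg_shift f x e (a b s : R) : continuous f -> a <= b ->
  seg e a b f x = seg e (a + s) (b + s) f (x - s *: e).
Proof.
move=> cf ab; rewrite /seg -integ_shift//; last exact: continuous_line.
by apply: eq_integ => t _; rewrite scalerDl addrCA subrK addrC.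
Qed.

Lemma seg0 e a b x : seg e a b (fun=> 0 : R) x = 0.
Proof. exact: integ0. Qed.

Lemma seg_eq0 e a b f x :
  (forall t, a <= t <= b -> f (x + t *: e) = 0) -> seg e a b f x = 0.
Proof. by move=> f0; rewrite -[RHS](seg0 e a b x); exact: eq_seg. Qed.

Lemma le_seg e a b f g x : continuous f -> continuous g ->
  (forall t, a <= t <= b -> f (x + t *: e) <= g (x + t *: e)) ->
  seg e a b f x <= seg e a b g x.
Proof. by move=> cf cg fg; apply: le_integ => //; exact: continuous_line. Qed.

Definition cube (B : R) f : R :=
  seg (delta R i0) (- B) B (seg (delta R i1) (- B) B (seg (delta R i2) (- B) B f)) 0.

Definition in_cube (B : R) x := forall i, `|x ord0 i| <= B.

Lemma in_cubeP B (r s t : R) : - B <= r <= B -> - B <= s <= B -> - B <= t <= B ->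
  in_cube B (0 + r *: delta R i0 + s *: delta R i1 + t *: delta R i2).
Proof.
rewrite -!ler_norml => rB sB tB; apply: ord3P; rewrite !mxE/=;
  by rewrite !(mulr0, mulr1, addr0, add0r).
Qed.

Variable B : R.
Hypothesis B0 : 0 < B.
Let BB : - B <= B. Proof. by move: B0 => b0; lra. Qed.
Local Hint Resolve BB : core.

Lemma le_cube f g : continuous f -> continuous g ->
  (forall x, in_cube B x -> f x <= g x) -> cube B f <= cube B g.
Proof.
move=> cf cg fg; apply: le_seg => [||r rB]; try by do ?apply: seg_continuous.
apply: le_seg => [||s sB]; try by do ?apply: seg_continuous.
by apply: le_seg => // t tB; exact/fg/in_cubeP.
Qed.

Lemma eq_cube f g : (forall x, in_cube B x -> f x = g x) -> cube B f = cube B g.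
Proof.
move=> fg; apply: eq_seg => r rB; apply: eq_seg => s sB; apply: eq_seg => t tB.
exact/fg/in_cubeP.
Qed.

Lemma cubeD f g : continuous f -> continuous g ->
  cube B (fun x => f x + g x) = cube B f + cube B g.
Proof.
move=> cf cg; rewrite /cube -segD; try by do ?apply: seg_continuous.
apply: eq_seg => r _; rewrite -segD; try by do ?apply: seg_continuous.
by apply: eq_seg => s _; rewrite -segD.
Qed.

Lemma cubeZ k f : continuous f -> cube B (fun x => k * f x) = k * cube B f.
Proof.
move=> cf; rewrite /cube -segZ; try by do ?apply: seg_continuous.
apply: eq_seg => r _; rewrite -segZ; try by do ?apply: seg_continuous.
by apply: eq_seg => s _; rewrite -segZ.
Qed.

Lemma cubeN f : continuous f -> cube B (fun x => - f x) = - cube B f.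
Proof.
move=> cf; rewrite -[RHS]mulN1r -(cubeZ (-1) cf); apply: eq_cube => x _.
by rewrite mulN1r.
Qed.

Lemma cubeB f g : continuous f -> continuous g ->
  cube B (fun x => f x - g x) = cube B f - cube B g.
Proof. by move=> cf cg; rewrite cubeD ?cubeN//; exact: contN. Qed.

Lemma cube0 : cube B (fun=> 0 : R) = 0.
Proof. by apply: seg_eq0 => r _; apply: seg_eq0 => s _; exact: seg0. Qed.

Lemma cube_sum (I : Type) (r : seq I) (F : I -> E3 -> R) :
  (forall i, continuous (F i)) ->
  cube B (fun x => \sum_(i <- r) F i x) = \sum_(i <- r) cube B (F i).
Proof.
move=> cF; elim: r => [|i r IH].
  by rewrite big_nil -[RHS]cube0; apply: eq_cube => x _; rewrite big_nil.
transitivity (cube B (fun x => F i x + \sum_(j <- r) F j x)).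
  by apply: eq_cube => x _; rewrite big_cons.
by rewrite [RHS]big_cons -IH; apply: cubeD => //; exact: cont_sum.
Qed.

Lemma cube_ge0 f : continuous f -> (forall x, in_cube B x -> 0 <= f x) -> 0 <= cube B f.
Proof. by move=> cf f0; rewrite -cube0; apply: le_cube => //; exact: cont_cst. Qed.

(** Positivity is propagated through the three integrations, one variable at a
    time. *)
Lemma cube_gt0 f x : continuous f -> (forall y, 0 <= f y) ->
  (forall i, `|x ord0 i| < B) -> 0 < f x -> 0 < cube B f.
Proof.
move=> cf f0 xB fx; have s0 g e y : (forall y, 0 <= g y) -> 0 <= seg e (- B) B g y.
  by move=> g0; apply: integ_ge0 => t; exact: g0.
have xi i : - B < x ord0 i < B by rewrite -ltr_norml.
apply: (integ_gt0 (t0 := x ord0 i0)) => [|t||].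
- by apply: continuous_line; do ?apply: seg_continuous.
- by apply: (s0) => ?; apply: (s0) => ?; exact: f0.
- exact: xi.
apply: (integ_gt0 (t0 := x ord0 i1)) => [|t||].
- by apply: continuous_line; do ?apply: seg_continuous.
- by apply: (s0) => ?; exact: f0.
- exact: xi.
apply: (integ_gt0 (t0 := x ord0 i2)) => [|t||].
- exact: continuous_line.
- exact: f0.
- exact: xi.
by rewrite add0r -row_delta.
Qed.

(** Integrate first along the axis i: only values of f on two faces remain. *)
Lemma cube_partial i f g : Cdir (delta R i) f g ->
  (forall x, in_cube B x -> `|x ord0 i| = B -> f x = 0) -> cube B g = 0.
Proof.
move=> C f0; have cg : continuous g by case: C.
have nB : `|B| = B by rewrite gtr0_norm.
have B1 : - B <= B <= B by rewrite lexx BB.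
have B2 : - B <= - B <= B by rewrite lexx BB.
have P0 (r s t : R) : (0 + r *: delta R i0 + s *: delta R i1 + t *: delta R i2) ord0 i0 = r.
  by rewrite !mxE/= !(mulr0, mulr1, addr0, add0r).
have P1 (r s t : R) : (0 + r *: delta R i0 + s *: delta R i1 + t *: delta R i2) ord0 i1 = s.
  by rewrite !mxE/= !(mulr0, mulr1, addr0, add0r).
have P2 (r s t : R) : (0 + r *: delta R i0 + s *: delta R i1 + t *: delta R i2) ord0 i2 = t.
  by rewrite !mxE/= !(mulr0, mulr1, addr0, add0r).
move: C f0; move: i; apply: ord3P => C f0; rewrite /cube.
- rewrite seg_comm//; last exact: seg_continuous.
  apply: seg_eq0 => s sB; rewrite seg_comm//.
  apply: seg_eq0 => t tB; rewrite (seg_Cdir _ C)//.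
  have E (r : R) : 0 + s *: delta R i1 + t *: delta R i2 + r *: delta R i0 =
      0 + r *: delta R i0 + s *: delta R i1 + t *: delta R i2.
    by rewrite !add0r addrC addrA.
  by rewrite !E !f0 ?subrr ?P0 ?normrN//; exact: in_cubeP.
- apply: seg_eq0 => s sB; rewrite seg_comm//.
  apply: seg_eq0 => t tB; rewrite (seg_Cdir _ C)//.
  have E (r : R) : 0 + s *: delta R i0 + t *: delta R i2 + r *: delta R i1 =
      0 + s *: delta R i0 + r *: delta R i1 + t *: delta R i2.
    by rewrite addrAC.
  by rewrite !E !f0 ?subrr ?P1 ?normrN//; exact: in_cubeP.
- apply: seg_eq0 => s sB; apply: seg_eq0 => t tB; rewrite (seg_Cdir _ C)//.
  by rewrite !f0 ?subrr ?P2 ?normrN//; exact: in_cubeP.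
Qed.

End Cube.

Section Lines.
Variable R : realType.
Local Notation E3 := 'rV[R]_3.
Implicit Types (f g : E3 -> R) (x d e y : E3).

Definition C1 f := forall i, Cdir (delta R i) f (partial i f).

Definition grad_dot d f x := \sum_i d ord0 i * partial i f x.

Lemma C1_cont f : C1 f -> continuous f.
Proof. by move/(_ i0); case. Qed.

Lemma Cdir_eq d f g g' : Cdir d f g -> g =1 g' -> Cdir d f g'.
Proof. by move=> + /funext gg'; rewrite gg'. Qed.

Lemma Cdir_unique d f g g' x : Cdir d f g -> Cdir d f g' -> g x = g' x.
Proof.
move=> [_ _ /(_ x)D] [_ _ /(_ x)D'].
by rewrite -(@derive_val _ _ _ _ _ _ _ D) (@derive_val _ _ _ _ _ _ _ D').
Qed.

Lemma Cdir_delta d f (g : 'I_3 -> E3 -> R) : (forall i, Cdir (delta R i) f (g i)) ->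
  Cdir d f (fun x => \sum_i d ord0 i * g i x).
Proof.
move=> C; rewrite {1}(row_delta d).
have := Cdir_addv (Cdir_addv (Cdir_scale (d ord0 i0) (C i0))
  (Cdir_scale (d ord0 i1) (C i1))) (Cdir_scale (d ord0 i2) (C i2)).
by move/Cdir_eq; apply => x; rewrite sum3.
Qed.

Lemma C1_Cdir d f : C1 f -> Cdir d f (grad_dot d f).
Proof. exact: Cdir_delta. Qed.

Lemma C1I f (g : 'I_3 -> E3 -> R) : (forall i, Cdir (delta R i) f (g i)) ->
  C1 f /\ forall i x, partial i f x = g i x.
Proof.
move=> C; have P i x : partial i f x = g i x.
  by have [_ _ /(_ x) D] := C i; exact: (@derive_val _ _ _ _ _ _ _ D).
by split=> // i; apply: (Cdir_eq (C i)) => x.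
Qed.

Lemma supp_shift K f e x (t : R) : supp K f -> dot e e = 1 ->
  K < `|dot e x + t| -> f (x + t *: e) = 0.
Proof. by move=> s e1 Kt; apply: (s _ e) => //; rewrite dotDr dotZr e1 mulr1. Qed.

(** Let u be the integral of f over the half-line that ends at x and has
    direction e. Then u has derivative f along e, and u vanishes on the boundary
    of the cube, since a half-line from a boundary point either misses the
    support or meets the same part of it as the whole line. So the integral of f
    is that of a combination of partial derivatives of u. *)
Lemma cube_lines f e K B : 0 < K < B -> C1 f -> supp K f -> dot e e = 1 ->
  (forall y (L : R), dot e y = 0 -> K <= L -> seg e (- L) L f y = 0) ->
  cube B f = 0.
Proof.
move=> /andP[K0 KB] Cf sf e1 f0; have B0 : 0 < B by lra.
pose L := 6 * B + K + 1; have L0 : - L <= 0 by rewrite /L; lra.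
have cf := C1_cont Cf.
pose u := seg e (- L) 0 f.
have small x : in_cube B x -> - (3 * B) <= dot e x <= 3 * B.
  by move=> xB; rewrite -ler_norml; exact: dot_le.
have Cu i : Cdir (delta R i) u (seg e (- L) 0 (partial i f)).
  by apply: Cdir_seg_under => //; exact: Cf.
have D1 := Cdir_delta e Cu; have D2 := Cdir_seg e cf L0.
transitivity (cube B (fun x => \sum_i e ord0 i * seg e (- L) 0 (partial i f) x)).
  apply: eq_cube => x /small xB; rewrite (Cdir_unique x D1 D2).
  rewrite scale0r addr0 (supp_shift sf e1) ?subr0//.
  by rewrite ltr0_norm /L; lra.
rewrite cube_sum//; last by move=> i; apply: contZ; case: (Cu i).
apply: big1 => i _; rewrite cubeZ//; last by case: (Cu i).
have [ei|ei] := eqVneq (e ord0 i) 0; first by rewrite ei mul0r.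
rewrite (cube_partial B0 (Cu i)) ?mulr0// => x xB xi.
have xin := small _ xB.
case: (ltP 0 (x ord0 i * e ord0 i)) => xe; last first.
  apply: seg_eq0 => t /andP[_ t0]; apply: (supp_coord (i := i) sf).
  rewrite !mxE; apply: (lt_le_trans KB).
  rewrite -(@ler_pXn2r _ 2%N)// ?nnegrE ?normr_ge0 ?(ltW B0)// real_normK ?num_real//.
  rewrite -xi real_normK ?num_real// sqrrD.
  have : 0 <= (x ord0 i * e ord0 i) * t by rewrite mulr_le0.
  have := sqr_ge0 (t * e ord0 i); rewrite -mulr_natr; nra.
pose t := dot e x; pose L1 := L - 2 * t.
have L10 : 0 <= L1 by rewrite /L1 /L /t; lra.
have E : seg e (- L) L1 f x = 0.
  rewrite (seg_shift x e t cf); last by lra.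
  have -> : - L + t = - (L - t) by ring.
  have -> : L1 + t = L - t by rewrite /L1; ring.
  apply: f0; first by rewrite dotDr -scaleNr dotZr e1 mulr1 subrr.
  by rewrite /L /t; lra.
rewrite -E /u /seg (integ_split (a := - L) (c := 0) (b := L1)); last 2 first.
- exact: continuous_line.
- by rewrite L0.
rewrite -[LHS]addr0; congr (_ + _); apply/esym/(@seg_eq0 R e 0 L1 f x) => s /andP[s0 _].
apply: (supp_coord (i := i) sf); rewrite !mxE; apply: (lt_le_trans KB).
rewrite -(@ler_pXn2r _ 2%N)// ?nnegrE ?normr_ge0 ?(ltW B0)// real_normK ?num_real//.
rewrite -xi real_normK ?num_real// sqrrD.
have : 0 <= (x ord0 i * e ord0 i) * s by rewrite mulr_ge0// ltW.
have := sqr_ge0 (s * e ord0 i); rewrite -mulr_natr; nra.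
Qed.

End Lines.

(** * Ridge polynomials detect continuous functions *)

Lemma power_gap (R : realType) (q1 q2 c G : R) : 0 <= q1 -> q1 < q2 ->
  (forall n, c * q2 ^+ n <= q1 ^+ n * G) -> c <= 0.
Proof.
move=> q1_ge0 q12 key; rewrite leNgt; apply/negP => c0.
have q2_gt0 : 0 < q2 by exact: le_lt_trans q12.
pose z := q1 / q2.
have z0 : 0 <= z by rewrite divr_ge0// ltW.
have z1 : z < 1 by rewrite ltr_pdivrMr// mul1r.
have : (z ^+ n * G) @[n --> \oo] --> 0 * G.
  apply: cvgM; last exact: cvg_cst.
  by apply: cvg_expr; rewrite ger0_norm.
rewrite mul0r => /cvgrPdist_lt /(_ c c0).
move=> [N _ /(_ N (leqnn N))] /=; rewrite sub0r normrN => zN.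
have := le_lt_trans (ler_norm _) zN; apply/negP; rewrite -leNgt.
have qN : 0 < q2 ^+ N by rewrite exprn_gt0.
have zq : z ^+ N * q2 ^+ N = q1 ^+ N by rewrite -exprMn divfK// gt_eqF.
rewrite -(ler_pM2r qN) (mulrAC (z ^+ N) G) zq.
exact: key.
Qed.

Section Ridge.
Variable R : realType.
Local Notation E3 := 'rV[R]_3.
Implicit Types (P : E3 -> R) (x a w eta : E3).

Lemma poly_all_roots (p : {poly R}) : (forall t, p.[t] = 0) -> p = 0.
Proof.
move=> p0; apply/eqP; apply: contraT => pn0.
pose rs := [seq i%:R : R | i <- iota 0 (size p)].
have : (size rs < size p)%N.
  apply: max_poly_roots => //; first by apply/allP => t _; rewrite /root p0.
  by rewrite map_inj_uniq ?iota_uniq// => i j /eqP; rewrite eqr_nat => /eqP.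
by rewrite size_map size_iota ltnn.
Qed.

Variables (B : R) (g : E3 -> R).
Hypotheses (B0 : 0 < B) (cg : continuous g).

(** Products of linear forms span the polynomials. *)
Definition linprod (s : seq E3) x : R := \prod_(eta <- s) dot eta x.

Lemma linprod_cons eta s x : linprod (eta :: s) x = dot eta x * linprod s x.
Proof. by rewrite /linprod big_cons. Qed.

Lemma linprod_continuous s : continuous (linprod s).
Proof.
elim: s => [|eta s IH].
  rewrite (_ : linprod [::] = fun=> 1); first exact: cont_cst.
  by apply/funext => x; rewrite /linprod big_nil.
rewrite (_ : linprod (eta :: s) = fun x => dot eta x * linprod s x).
  by apply: contM => //; exact: dot_continuous.
by apply/funext => x; rewrite linprod_cons.
Qed.

Hypothesis ridge0 : forall w k, cube B (fun x => g x * dot w x ^+ k) = 0.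

(** Ridge polynomials span all polynomials: replacing w by w + t eta in the
    moment of degree k + 1 gives a polynomial in t which vanishes identically,
    and its coefficient of degree 1 is, up to the factor k + 1, the moment of
    degree k with one more linear factor. *)
Lemma linprod_ridge0 s w k : cube B (fun x => g x * linprod s x * dot w x ^+ k) = 0.
Proof.
elim: s w k => [|eta s IH] w k.
  by rewrite -[RHS](ridge0 w k); apply: eq_cube => x _; rewrite /linprod big_nil mulr1.
pose c (j : nat) := cube B (fun x => g x * linprod s x *
  ((dot w x ^+ (k.+1 - j) * dot eta x ^+ j) *+ 'C(k.+1, j))).
have cc (j : nat) : continuous (fun x => g x * linprod s x *
  ((dot w x ^+ (k.+1 - j) * dot eta x ^+ j) *+ 'C(k.+1, j))).
  apply: contM; first by apply: contM => //; exact: linprod_continuous.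
  under eq_fun do rewrite -mulr_natl.
  by apply/contZ/contM; apply: contX; exact: dot_continuous.
have p0 : \poly_(j < k.+2) c j = 0.
  apply: poly_all_roots => t; rewrite horner_poly.
  rewrite -[RHS](IH (w + t *: eta) k.+1).
  transitivity (cube B (fun x => \sum_(j < k.+2) t ^+ j * (g x * linprod s x *
    ((dot w x ^+ (k.+1 - j) * dot eta x ^+ j) *+ 'C(k.+1, j))))).
    rewrite cube_sum//; last by move=> j; apply/contZ/cc.
    by apply: eq_bigr => j _; rewrite cubeZ ?(mulrC (c j))//; exact: cc.
  apply: eq_cube => x _; rewrite dotDl dotZl exprDn mulr_sumr.
  apply: eq_bigr => j _; rewrite exprMn !mulrnAr; congr (_ *+ _).
  have AC (T C A F : R) : T * (C * (A * F)) = C * (A * (T * F)) by ring.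
  exact: AC.
have /(congr1 (fun p : {poly R} => p`_1)) := p0.
rewrite coef_poly coef0/= /c bin1 => c1.
have : (k.+1%:R : R) * cube B (fun x => g x * linprod (eta :: s) x * dot w x ^+ k) = 0.
  have cL : continuous (fun x => g x * linprod (eta :: s) x * dot w x ^+ k).
    apply: contM; last by apply: contX; exact: dot_continuous.
    by apply: contM => //; exact: linprod_continuous.
  rewrite -[RHS]c1 -(cubeZ B0 k.+1%:R cL).
  apply: eq_cube => x _; rewrite linprod_cons subSS subn0 expr1 mulrnAr -[RHS]mulr_natl.
  have AC (T C E A F : R) : T * (C * (E * A) * F) = T * (C * A * (F * E)) by ring.
  exact: AC.
by move/eqP; rewrite mulf_eq0 pnatr_eq0 /= => /eqP.
Qed.

(** The factors from [linprod] make this set of functions P stable under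
    multiplication by polynomials. *)
Definition orth P := continuous P /\ forall s, cube B (fun x => g x * P x * linprod s x) = 0.

Lemma orth1 : orth (fun=> 1).
Proof.
split=> [|s]; first exact: cont_cst.
rewrite -[RHS](linprod_ridge0 s 0 0); apply: eq_cube => x _.
by rewrite expr0 !mulr1.
Qed.

Let cont_orth P s : continuous P -> continuous (fun x => g x * P x * linprod s x).
Proof. by move=> cP; apply: contM; [exact: contM|exact: linprod_continuous]. Qed.

Lemma orthZ k P : orth P -> orth (fun x => k * P x).
Proof.
move=> [cP P0]; split=> [|s]; first exact: contZ.
transitivity (cube B (fun x => k * (g x * P x * linprod s x))).
  by apply: eq_cube => x _; rewrite (mulrCA (g x)) -[LHS]mulrA.
by rewrite (cubeZ B0 k (cont_orth (s := s) cP)) P0 mulr0.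
Qed.

Lemma orthD P Q : orth P -> orth Q -> orth (fun x => P x + Q x).
Proof.
move=> [cP P0] [cQ Q0]; split=> [|s]; first exact: contD.
transitivity (cube B (fun x => g x * P x * linprod s x + g x * Q x * linprod s x)).
  by apply: eq_cube => x _; rewrite mulrDr mulrDl.
by rewrite (cubeD B0 (cont_orth (s := s) cP) (cont_orth (s := s) cQ)) P0 Q0 addr0.
Qed.

Lemma orth_lin eta P : orth P -> orth (fun x => dot eta x * P x).
Proof.
move=> [cP P0]; split=> [|s]; first by apply: contM => //; exact: dot_continuous.
transitivity (cube B (fun x => g x * P x * linprod (eta :: s) x)); last exact: P0.
by apply: eq_cube => x _; rewrite linprod_cons (mulrC (dot eta x)) !mulrA.
Qed.

Lemma orth_eq P Q : P =1 Q -> orth P -> orth Q.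
Proof. by move/funext ->. Qed.

(** The powers of this function, normalized, concentrate at a. *)
Definition bowl (r : R) a x := 1 - r * dot (x - a) (x - a).

Lemma orth_bowl r a P : orth P -> orth (fun x => bowl r a x * P x).
Proof.
move=> oP.
have o2 i : orth (fun x => dot (delta R i) x * (dot (delta R i) x * P x)).
  by do 2 apply: orth_lin.
apply: (orth_eq (P := fun x => ((1 - r * dot a a) * P x + (2 * r) * (dot a x * P x))
  + (- r) * (dot (delta R i0) x * (dot (delta R i0) x * P x)
  + (dot (delta R i1) x * (dot (delta R i1) x * P x)
  + dot (delta R i2) x * (dot (delta R i2) x * P x))))).
  by move=> x; rewrite /bowl !dot_delta !dot3 !mxE; ring.
apply: orthD; first by apply: orthD; [exact: orthZ|exact/orthZ/orth_lin].
exact: (orthZ (- r) (orthD (o2 i0) (orthD (o2 i1) (o2 i2)))).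
Qed.

Lemma orth_bowlX r a n : orth (fun x => bowl r a x ^+ n).
Proof.
elim: n => [|n IH]; first exact: orth1.
by apply: orth_eq (orth_bowl r a IH) => x; rewrite exprS.
Qed.

Lemma cube_bowl0 r a n : cube B (fun x => g x * bowl r a x ^+ n) = 0.
Proof.
have [_ /(_ [::]) <-] := orth_bowlX r a n.
by apply: eq_cube => x _; rewrite /linprod big_nil mulr1.
Qed.

Lemma dot_sqr_ge0 x : 0 <= dot x x.
Proof. by rewrite dot3 !addr_ge0// -expr2 sqr_ge0. Qed.

Lemma coord_sqr_le x i : x ord0 i ^+ 2 <= dot x x.
Proof.
rewrite dot3; move: i; apply: ord3P; rewrite !expr2;
  have := sqr_ge0 (x ord0 i0); have := sqr_ge0 (x ord0 i1);
  have := sqr_ge0 (x ord0 i2); rewrite !expr2; lra.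
Qed.

(** Landau's argument: if g (a) were positive, the powers of [bowl] would be
    larger near a than far from a by an exponential factor, so that their
    integrals against g could not all vanish. The function chi is a continuous
    bump near a that separates the two regions. *)
Lemma ridge_le0 a : (forall i, `|a ord0 i| < B) -> g a <= 0.
Proof.
move=> aB; rewrite leNgt; apply/negP => ga.
pose D x := dot (x - a) (x - a).
have cD : continuous D.
  have cc i : continuous (fun x : E3 => dot (delta R i) x - dot (delta R i) a).
    by apply: contD; [exact: dot_continuous|exact: cont_cst].
  rewrite (_ : D = fun x => (dot (delta R i0) x - dot (delta R i0) a) ^+ 2
    + (dot (delta R i1) x - dot (delta R i1) a) ^+ 2
    + (dot (delta R i2) x - dot (delta R i2) a) ^+ 2).
    by apply: contD; [apply: contD|]; exact: contX.
  by apply/funext => x; rewrite /D !dot_delta dot3 !mxE !expr2.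
have ga2 : 0 < g a / 2 by rewrite divr_gt0.
have /cvgrPdist_le /(_ _ ga2)/nbhs_ballP[e0 /= e00 eg] := @cg a.
pose e := Num.min (e0 / 2) B.
have e_gt0 : 0 < e by rewrite lt_min divr_gt0// B0.
have [ee0 eB] : e <= e0 / 2 /\ e <= B by rewrite /e !ge_min !lexx ?orbT.
have near_a x : D x <= e ^+ 2 -> g a / 2 <= g x.
  move=> Dx; have : `|g a - g x| <= g a / 2.
    apply: eg; split => // i j; rewrite (ord1 i) /ball/=; apply: (@le_lt_trans _ _ e); last by lra.
    rewrite -(@ler_pXn2r _ 2%N)// ?nnegrE ?normr_ge0 ?(ltW e_gt0)// real_normK ?num_real//.
    apply: le_trans Dx; rewrite /D -opprB sqrrN.
    by have := coord_sqr_le (x - a) j; rewrite !mxE.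
  by rewrite ler_norml => /andP[]; lra.
pose r := (12 * B ^+ 2)^-1.
have B2 : 0 < 12 * B ^+ 2 by rewrite mulr_gt0// exprn_gt0.
have r0 : 0 < r by rewrite invr_gt0.
have Q0 x : in_cube B x -> 0 <= bowl r a x.
  move=> xB; rewrite /bowl subr_ge0 /r mulrC ler_pdivrMr// mul1r.
  have h i : (x - a) ord0 i ^+ 2 <= 4 * B ^+ 2.
    rewrite !mxE; have := xB i; have := aB i.
    rewrite ltr_norml ler_norml => /andP[? ?] /andP[? ?].
    have -> : 4 * B ^+ 2 = (2 * B) ^+ 2 by ring.
    rewrite -real_normK ?num_real// ler_pXn2r// ?nnegrE ?normr_ge0//; last by lra.
    by rewrite ler_norml; apply/andP; split; lra.
  by rewrite dot3; have := h i0; have := h i1; have := h i2; rewrite !expr2; lra.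
pose q1 := 1 - r * e ^+ 2; pose q2 := 1 - r * (e ^+ 2 / 2).
have e2 : 0 < e ^+ 2 by rewrite exprn_gt0.
have q1_ge0 : 0 <= q1.
  rewrite subr_ge0 /r mulrC ler_pdivrMr// mul1r.
  have : e ^+ 2 <= B ^+ 2 by rewrite ler_pXn2r ?nnegrE ?(ltW e_gt0) ?(ltW B0).
  by have := exprn_gt0 2 B0; lra.
have q12 : q1 < q2.
  by rewrite /q1 /q2 ltrD2l ltrN2 ltr_pM2l//; lra.
have q2_gt0 : 0 < q2 by exact: le_lt_trans q12.
pose u x := e ^+ 2 / 2 - D x; pose chi x := 2^-1 * (u x + `|u x|).
have cu : continuous u by apply: contD; [exact: cont_cst|exact: contN].
have cchi : continuous chi.
  by apply: contZ; apply: contD => // x; exact: (cvg_norm (@cu x)).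
have chiE x : 0 <= u x -> chi x = u x.
  by move=> u0; rewrite /chi ger0_norm//; lra.
have chiE0 x : u x <= 0 -> chi x = 0.
  by move=> u0; rewrite /chi ler0_norm// subrr mulr0.
have chi0 x : 0 <= chi x.
  by case: (leP 0 (u x)) => [u0|/ltW u0]; [rewrite chiE|rewrite chiE0].
have ua : u a = e ^+ 2 / 2 by rewrite /u /D subrr dot3 !mxE !mulr0 !addr0 subr0.
have chi_int : 0 < cube B chi.
  by apply: (cube_gt0 B0 (x := a)) => //; rewrite chiE ua ?divr_gt0// ltW ?divr_gt0.
pose c := g a / e ^+ 2; have c0 : 0 < c by rewrite divr_gt0.
pose G := cube B (fun x => `|g x|).
have cG : continuous (fun x => `|g x|).
  by move=> x; exact: (cvg_norm (@cg x)).
have cbowl n : continuous (fun x => g x * bowl r a x ^+ n).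
  by apply: contM => //; case: (orth_bowlX r a n).
have c1 n : continuous (fun x => q1 ^+ n * `|g x|) by exact: contZ.
have c2 n : continuous (fun x => - (c * q2 ^+ n) * chi x) by exact: contZ.
have key n : c * q2 ^+ n * cube B chi <= q1 ^+ n * G.
  suff : 0 <= cube B (fun x => q1 ^+ n * `|g x| + - (c * q2 ^+ n) * chi x +
      g x * bowl r a x ^+ n).
    rewrite (cubeD B0 (contD (c1 n) (c2 n)) (cbowl n)) cube_bowl0 addr0.
    rewrite (cubeD B0 (c1 n) (c2 n)) (cubeZ B0 _ cG) (cubeZ B0 _ cchi) -/G.
    by rewrite mulNr subr_ge0.
  apply: cube_ge0 => //; first exact: contD (contD (c1 n) (c2 n)) (cbowl n).
  move=> x xB; have D0 : 0 <= D x by exact: dot_sqr_ge0.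
  have Qx := Q0 x xB.
  have gq1 : 0 <= q1 ^+ n * `|g x| by rewrite mulr_ge0// exprn_ge0.
  case: (leP (D x) (e ^+ 2 / 2)) => Dx.
    have gx : g a / 2 <= g x by apply: near_a; lra.
    have chix : c * chi x <= g a / 2.
      rewrite chiE ?subr_ge0// /c mulrAC ler_pdivrMr//.
      by rewrite mulrAC -mulrA ler_pM2l// /u; lra.
    have Qn : q2 ^+ n <= bowl r a x ^+ n.
      apply: lerXn2r; rewrite ?nnegrE ?(ltW q2_gt0)//.
      by rewrite /bowl /q2 lerD2l lerN2 ler_pM2l.
    have : c * chi x * q2 ^+ n <= g x * bowl r a x ^+ n.
      apply: ler_pM => //; first by rewrite mulr_ge0// ltW.
        by rewrite exprn_ge0// ltW.
      by exact: le_trans gx.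
    by rewrite mulNr mulrAC; lra.
  have -> : chi x = 0 by apply: chiE0; rewrite /u; lra.
  rewrite mulr0 addr0; case: (leP (D x) (e ^+ 2)) => Dx2.
    have gx : 0 <= g x by apply: le_trans (near_a x Dx2); exact: ltW.
    by rewrite addr_ge0// mulr_ge0// exprn_ge0.
  have Qn : bowl r a x ^+ n <= q1 ^+ n.
    apply: lerXn2r; rewrite ?nnegrE//.
    by rewrite /bowl /q1 lerD2l lerN2 ler_pM2l// ltW.
  rewrite -lerBlDr sub0r; apply: (@le_trans _ _ `|g x * bowl r a x ^+ n|).
    by rewrite -normrN ler_norm.
  by rewrite normrM (ger0_norm (exprn_ge0 _ Qx)) mulrC ler_wpM2r.
have : c * cube B chi <= 0.
  by apply: (power_gap q1_ge0 q12) => n; rewrite mulrAC; exact: key.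
by apply/negP; rewrite -ltNge mulr_gt0.
Qed.

End Ridge.

Lemma ridge_eq0 (R : realType) (B K : R) (g : 'rV[R]_3 -> R) :
  0 < K < B -> continuous g -> supp K g ->
  (forall w k, cube B (fun x => g x * dot w x ^+ k) = 0) ->
  forall x, g x = 0.
Proof.
move=> /andP[K0 KB] cg sg g0 x; have B0 : 0 < B by lra.
have [xB|] := pselect (forall i, `|x ord0 i| < B); last first.
  move=> /existsNP[i /negP]; rewrite -leNgt => xi; apply: (supp_coord (i := i) sg).
  by rewrite (lt_le_trans KB).
have ngw w k : cube B (fun x => - g x * dot w x ^+ k) = 0.
  transitivity (cube B (fun x => - (g x * dot w x ^+ k))).
    by apply: eq_cube => y _; rewrite mulNr.
  rewrite cubeN ?g0 ?oppr0//.
  by apply: contM => //; apply: contX; exact: dot_continuous.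
have := ridge_le0 B0 (contN cg) ngw xB; rewrite oppr_le0 => gx.
by apply: le_anti; rewrite gx (ridge_le0 B0 cg g0 xB).
Qed.

(** * Functions of class C^1 and orthonormal frames *)

Section C1Closure.
Variable R : realType.
Local Notation E3 := 'rV[R]_3.
Implicit Types (f g : E3 -> R) (x d e y : E3).

Lemma smooth_C1 f : smooth f -> C1 f.
Proof.
move=> sf i; have [cf df] := sf [::]; have [cg _] := sf [:: i].
by split => // x; have := df i x => dx; split.
Qed.

Lemma smooth_partial i f : smooth f -> smooth (partial i f).
Proof.
move=> sf s; have := sf (rcons s i).
by rewrite /iter_partial foldr_rcons.
Qed.

Lemma C1D f g : C1 f -> C1 g -> C1 (fun x => f x + g x) /\
  forall i x, partial i (fun x => f x + g x) x = partial i f x + partial i g x.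
Proof. by move=> Cf Cg; apply: C1I => i; exact: CdirD. Qed.

Lemma C1M f g : C1 f -> C1 g -> C1 (fun x => f x * g x) /\
  forall i x, partial i (fun x => f x * g x) x =
    f x * partial i g x + g x * partial i f x.
Proof. by move=> Cf Cg; apply: C1I => i; exact: CdirM. Qed.

Lemma C1Z k f : C1 f -> C1 (fun x => k * f x) /\
  forall i x, partial i (fun x => k * f x) x = k * partial i f x.
Proof. by move=> Cf; apply: C1I => i; exact: CdirZ. Qed.

Lemma C1_cst k : C1 (fun=> k : R) /\ forall i x, partial i (fun=> k) x = 0.
Proof. by apply: C1I => i; exact: Cdir_cst. Qed.

Lemma C1_sum (F : 'I_3 -> E3 -> R) : (forall i, C1 (F i)) ->
  C1 (fun x => \sum_i F i x) /\
  forall j x, partial j (fun x => \sum_i F i x) x = \sum_i partial j (F i) x.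
Proof.
move=> CF; apply: C1I => j.
have := CdirD (CdirD (CF i0 j) (CF i1 j)) (CF i2 j).
rewrite (_ : (fun x => F i0 x + F i1 x + F i2 x) = (fun x => \sum_i F i x)); last first.
  by apply/funext => x; rewrite sum3.
by move/Cdir_eq; apply => x; rewrite sum3.
Qed.

Lemma C1_dot w : C1 (dot w) /\ forall i x, partial i (dot w) x = w ord0 i.
Proof.
apply: C1I => i; split; [exact: dot_continuous|exact: cont_cst|].
move=> x; apply: (is_derive_slope (K := fun=> w ord0 i)) => [|h].
  exact: cont_cst.
by rewrite dotDr dotZr (dotC w (delta R i)) dot_delta; ring.
Qed.

Lemma C1X f n : C1 f -> C1 (fun x => f x ^+ n.+1) /\
  forall i x, partial i (fun x => f x ^+ n.+1) x = n.+1%:R * f x ^+ n * partial i f x.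
Proof.
move=> Cf; elim: n => [|n [C P]].
  by split=> [//|i x]; rewrite expr0 !mul1r.
have [C' P'] := C1M Cf C; split.
  by rewrite (_ : (fun x => f x ^+ n.+2) = (fun x => f x * f x ^+ n.+1)).
move=> i x; rewrite (_ : (fun x => f x ^+ n.+2) = (fun x => f x * f x ^+ n.+1))//.
by rewrite P' P -[n.+2]addn1 natrD !exprS; ring.
Qed.

End C1Closure.

Section Frames.
Variable R : realType.
Local Notation E3 := 'rV[R]_3.
Implicit Types (x d e y : E3).

(** In dimension three, three orthonormal vectors form a basis; this is used
    through [orthonormal3_complete]. *)
Definition orthonormal3 (F : 'I_3 -> E3) := forall i j, dot (F i) (F j) = (i == j)%:R.

(** A square matrix with orthonormal rows has orthonormal columns. *)
Lemma orthonormal3_complete (F : 'I_3 -> E3) : orthonormal3 F ->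
  forall j k, \sum_i F i ord0 j * F i ord0 k = (j == k)%:R.
Proof.
move=> oF; pose M := \matrix_(i, j) F i ord0 j.
have MM : M *m M^T = 1%:M.
  apply/matrixP => i j; rewrite !mxE -oF /dot.
  by apply: eq_bigr => k _; rewrite !mxE.
move=> j k; have /matrixP/(_ j k) := mulmx1C MM; rewrite !mxE => <-.
by apply: eq_bigr => i _; rewrite !mxE.
Qed.

Lemma orthonormal3_expand (F : 'I_3 -> E3) x y : orthonormal3 F ->
  dot x y = \sum_i dot (F i) x * dot (F i) y.
Proof.
move=> /orthonormal3_complete c.
transitivity (\sum_j \sum_k x ord0 j * y ord0 k * \sum_i F i ord0 j * F i ord0 k).
  under eq_bigr do under eq_bigr do rewrite c.
  by rewrite !sum3 dot3 /=; ring.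
by rewrite !sum3 !dot3; ring.
Qed.

Lemma half_plane_frame (m : oriented_line R) (h : half_plane m) :
  orthonormal3 (fun i : 'I_3 => nth 0 [:: direction m; inward h; normal h] i).
Proof.
have ee := direction_unit m; have nn := inward_unit h; have bb := normal_unit h.
have ne := inward_orth h; have be := normal_orth_direction h.
have bn := normal_orth_inward h.
apply: ord3P; apply: ord3P; rewrite /= ?ee ?nn ?bb ?ne ?be ?bn//;
  by rewrite dotC ?ne ?be ?bn.
Qed.

End Frames.

Lemma Cdir_shift (R : realType) (V : normedModType R) (d : V) (f g : V -> R) (z : V) : Cdir d f g ->
  Cdir d (fun x => f (x + z)) (fun x => g (x + z)).
Proof.
move=> [cf cg D].
have cz : continuous (fun x : V => x + z).
  by move=> x; apply: cvgD; [exact: cvg_id|exact: cvg_cst].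
split => x.
- exact: (continuous_comp (cz x) (cf (x + z))).
- exact: (continuous_comp (cz x) (cg (x + z))).
have D1 := D (x + z).
rewrite -(addr0 x) -(scale0r d); apply/is_derive_line.
have := D1; rewrite -{1}(addr0 (x + z)) -{1}(scale0r d) => /is_derive_line.
rewrite scale0r addr0.
have -> : (fun s : R => f (x + z + s *: d)) = (fun s => f (x + s *: d + z)).
  by apply/funext => s; rewrite addrAC.
by [].
Qed.

Section MoreCalculus.
Variable R : realType.
Local Notation E3 := 'rV[R]_3.
Implicit Types (f g : E3 -> R) (x d e y w : E3).

Lemma supp_le K K' f : K <= K' -> supp K f -> supp K' f.
Proof. by move=> KK' s x d d1 /(le_lt_trans KK'); exact: s. Qed.

Lemma suppD K f g : supp K f -> supp K g -> supp K (fun x => f x + g x).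
Proof. by move=> sf sg x d d1 h; rewrite (sf x d)// (sg x d)// addr0. Qed.

Lemma suppM K f g : supp K f -> supp K (fun x => f x * g x).
Proof. by move=> sf x d d1 h; rewrite (sf x d)// mul0r. Qed.

Lemma suppZ K k f : supp K f -> supp K (fun x => k * f x).
Proof. by move=> sf x d d1 h; rewrite (sf x d)// mulr0. Qed.

Lemma supp_sum K (F : 'I_3 -> E3 -> R) : (forall i, supp K (F i)) ->
  supp K (fun x => \sum_i F i x).
Proof. by move=> sF x d d1 h; apply: big1 => i _; exact: (sF i x d). Qed.

Lemma partial_near0 f i x : (\forall y \near x, f y = 0) -> partial i f x = 0.
Proof.
move=> f0; suff D : is_derive x (delta R i) f 0.
  exact: (@derive_val _ _ _ _ _ _ _ D).
have Dc := is_derive_cst (0 : R) x (delta R i).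
by apply: near_eq_is_derive Dc; apply: filterS f0 => y ->.
Qed.

Lemma supp_partial K f i : supp K f -> supp K (partial i f).
Proof.
move=> sf x d d1 h; apply: partial_near0.
have c : continuous (fun y => `|dot d y|).
  by move=> y; exact: (cvg_norm (@dot_continuous R d y)).
have : \forall y \near x, K < `|dot d y| by apply: cvgr_gt (c x) _ _.
by apply: filterS => y Ky; rewrite (sf _ d).
Qed.

Lemma supp_boundary K B f x i : supp K f -> K < B -> `|x ord0 i| = B -> f x = 0.
Proof. by move=> sf KB xi; apply: (supp_coord (i := i) sf); rewrite xi. Qed.

Lemma C1_pow w k : C1 (fun x => dot w x ^+ k).
Proof.
case: k => [|k]; first by have [] := C1_cst (1 : R).
by have [] := C1X k (C1_dot w).1.
Qed.

Lemma pow_continuous w k : continuous (fun x => dot w x ^+ k).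
Proof. exact: C1_cont (C1_pow w k). Qed.

Section IBP.
Variables (K B : R).
Hypotheses (K0 : 0 < K) (KB : K < B).
Let B0 : 0 < B. Proof. exact: lt_trans KB. Qed.

Lemma cube_partial0 f i : C1 f -> supp K f -> cube B (partial i f) = 0.
Proof.
by move=> Cf sf; apply: (cube_partial B0 (Cf i)) => x _; exact: supp_boundary KB.
Qed.

Lemma cube_ibp f g i : C1 f -> C1 g -> supp K f ->
  cube B (fun x => partial i f x * g x) = - cube B (fun x => f x * partial i g x).
Proof.
move=> Cf Cg sf; have [CM PM] := C1M Cf Cg.
have := cube_partial0 i CM (@suppM _ _ g sf).
have cf := C1_cont Cf; have cg := C1_cont Cg.
have [_ cf' _] := Cf i; have [_ cg' _] := Cg i.
have -> : cube B (partial i (fun x => f x * g x)) =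
    cube B (fun x => f x * partial i g x + partial i f x * g x).
  by apply: eq_cube => x _; rewrite PM (mulrC (g x)).
rewrite (cubeD B0 (contM cf cg') (contM cf' cg)) => /eqP.
by rewrite addr_eq0 => /eqP ->; rewrite opprK.
Qed.

Lemma cube_ibp_pow f i w k : C1 f -> supp K f ->
  cube B (fun x => partial i f x * dot w x ^+ k.+1) =
  - (k.+1%:R * w ord0 i * cube B (fun x => f x * dot w x ^+ k)).
Proof.
move=> Cf sf; rewrite (cube_ibp i Cf (C1_pow w k.+1) sf); congr (- _).
rewrite -(cubeZ B0 _ (contM (C1_cont Cf) (@pow_continuous w k))).
apply: eq_cube => x _; rewrite (C1X k (C1_dot w).1).2 (C1_dot w).2.
have AC (a b c d : R) : a * (b * c * d) = b * d * (a * c) by ring.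
exact: AC.
Qed.

End IBP.

(** Differentiate along axis i the identity that expresses an increment of f
    along axis j as an integral of its j-th derivative: this shows that the i-th
    derivative of f is an integral along j of the mixed derivative. *)
Lemma partial_comm f i j x : C1 f -> C1 (partial i f) -> C1 (partial j f) ->
  partial j (partial i f) x = partial i (partial j f) x.
Proof.
move=> Cf Ci Cj; have [_ D _] := Cj i.
suff C : Cdir (delta R j) (partial i f) (partial i (partial j f)).
  exact: (Cdir_unique x (Ci j) C).
apply: Cdir_of_seg => //; first exact: C1_cont Ci.
move=> y h /andP[h1 _]; have h1' : -1 <= h by exact: ltW.
have D1 : Cdir (delta R i) (seg (delta R j) (-1) h (partial j f))
    (seg (delta R j) (-1) h (partial i (partial j f))).
  by apply: Cdir_seg_under => //; exact: Cj.
have D2 := CdirD (Cdir_shift (h *: delta R j) (Cf i))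
  (CdirZ (-1) (Cdir_shift (- delta R j) (Cf i))).
have E : (fun x => f (x + h *: delta R j) + -1 * f (x + - delta R j)) =
    seg (delta R j) (-1) h (partial j f).
  by apply/funext => z; rewrite (seg_Cdir _ (Cf j))// scaleN1r mulN1r.
rewrite E in D2; have := Cdir_unique y D2 D1.
by rewrite mulN1r.
Qed.

(** A line parallel to one axis leaves the support, so one vanishing partial
    derivative suffices. *)
Lemma const_supp K f : C1 f -> supp K f -> (forall x, partial i0 f x = 0) ->
  forall x, f x = 0.
Proof.
move=> Cf sf f0 x; pose T := `|x ord0 i0| + `|K| + 1.
have T0 : 0 <= T by rewrite !addr_ge0.
have := seg_Cdir x (Cf i0) T0; rewrite scale0r addr0 seg_eq0; last by move=> t _; exact: f0.
move=> /eqP; rewrite eq_sym subr_eq0 => /eqP <-.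
apply: (supp_shift sf (delta_unit R i0)); rewrite dot_delta.
have := ler_norm (- x ord0 i0); rewrite normrN.
have := ler_norm K; have := ler_norm (x ord0 i0 + T); rewrite /T; lra.
Qed.

End MoreCalculus.

(** * From the flux through half-planes to integrals along lines *)

Section Flux.
Variable R : realType.
Local Notation E3 := 'rV[R]_3.
Implicit Types (f g : E3 -> R) (x d e y z : E3).

Lemma seg_window f e y (K L' L : R) : continuous f -> supp K f -> dot e e = 1 ->
  dot e y = 0 -> 0 < K < L' -> L' <= L -> seg e (- L) L f y = seg e (- L') L' f y.
Proof.
move=> cf sf e1 ey /andP[K0 KL'] L'L.
have cl : continuous (fun t : R => f (y + t *: e)) by exact: continuous_line.
have out (a b : R) : (forall t : R, a <= t <= b -> K < `|t|) -> seg e a b f y = 0.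
  by move=> h; apply: seg_eq0 => t /h tK; rewrite (supp_shift sf e1)// ey add0r.
have outl := out (- L) (- L'); have outr := out L' L.
rewrite /seg (integ_split (a := - L) (c := - L') (b := L))//; last first.
  by apply/andP; split; lra.
rewrite (integ_split (a := - L') (c := L') (b := L))//; last by apply/andP; split; lra.
rewrite [X in X + _ = _]outl; last first.
  by move=> t /andP[? ?]; rewrite ltr_normr; apply/orP; right; lra.
rewrite [X in _ + (_ + X) = _]outr ?add0r ?addr0//.
by move=> t /andP[? ?]; rewrite ltr_normr; apply/orP; left; lra.
Qed.

Lemma seg_lin e a b (k l : R) f g y : continuous f -> continuous g ->
  seg e a b (fun x => k * f x + l * g x) y = k * seg e a b f y + l * seg e a b g y.
Proof.
move=> cf cg; rewrite (segD e a b y (contZ (k := k) cf) (contZ (k := l) cg)).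
by rewrite (segZ e a b k y cf) (segZ e a b l y cg).
Qed.

Section OneFrame.
Variables (K : R) (e E1 E2 : E3) (Y1 Y2 Ye : E3 -> R).
Hypotheses (K0 : 0 < K).
Hypotheses (ee : dot e e = 1) (E11 : dot E1 E1 = 1) (E22 : dot E2 E2 = 1).
Hypotheses (eE1 : dot e E1 = 0) (eE2 : dot e E2 = 0) (E12 : dot E1 E2 = 0).
Hypotheses (C1Y1 : C1 Y1) (C1Y2 : C1 Y2) (C1Ye : C1 Ye).
Hypotheses (sY1 : supp K Y1) (sY2 : supp K Y2) (sYe : supp K Ye).
Hypothesis div0 : forall x, grad_dot e Ye x + grad_dot E1 Y1 x + grad_dot E2 Y2 x = 0.

Variables kap L T : R.
Hypotheses (kapE : kap = K + 1) (LE : L = 7 * kap) (TE : T = 4 * kap).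

Let k0 : 0 < kap. Proof. by move: K0 kapE => *; lra. Qed.
Let L0 : 0 <= L. Proof. by move: K0 kapE LE => *; lra. Qed.
Let LL : - L <= L. Proof. by move: K0 kapE LE => *; lra. Qed.
Let T0 : 0 <= T. Proof. by move: K0 kapE TE => *; lra. Qed.

(** The flux of the field through the half-plane bounded by the line through y
    of direction e, on the side of E1. The lengths L and T replace infinity: they
    exceed what the support allows for the points y in use. *)
Definition stream := seg e (- L) L (seg E1 0 L Y2).

Let E1e : dot E1 e = 0. Proof. by rewrite dotC. Qed.
Let E2e : dot E2 e = 0. Proof. by rewrite dotC. Qed.
Let E21 : dot E2 E1 = 0. Proof. by rewrite dotC. Qed.
Let dE := (dotDr, dotZr, ee, E11, E22, eE1, eE2, E12, E1e, E2e, E21).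

Let d1 := seg e (- L) L (fun x => Y2 (x + L *: E1) - Y2 (x + 0 *: E1)).
Let d2 := seg e (- L) L (seg E1 0 L (grad_dot E2 Y2)).

Let stream_d1 : Cdir E1 stream d1.
Proof. by apply: Cdir_seg_under => //; apply: Cdir_seg => //; exact: C1_cont. Qed.

Let stream_d2 : Cdir E2 stream d2.
Proof. by apply: Cdir_seg_under => //; apply: Cdir_seg_under => //; exact: C1_Cdir. Qed.

Let far (y : E3) : - (5 * kap) <= dot E1 y -> K < `|dot E1 y + L|.
Proof.
by move=> h; rewrite ltr_normr; apply/orP; left; move: K0 kapE LE => *; lra.
Qed.

(** The derivative of the flux when the half-plane is moved within its plane. *)
Let d1E y : - (5 * kap) <= dot E1 y -> d1 y = - seg e (- L) L Y2 y.
Proof.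
move=> h; rewrite -[RHS]mulN1r -(segZ e (- L) L (-1) y (C1_cont C1Y2)).
apply: eq_seg => t _; rewrite (supp_shift sY2 E11); last first.
  by apply: far; rewrite !dE mulr0 addr0.
by rewrite scale0r addr0 sub0r mulN1r.
Qed.

(** The derivative when the half-plane is moved along its normal: as the field
    is free of divergence, it reduces to a term on the boundary line. *)
Let d2E y : dot e y = 0 -> - (5 * kap) <= dot E1 y -> d2 y = seg e (- L) L Y1 y.
Proof.
move=> ey h.
have cg1 : continuous (grad_dot E1 Y1) by case: (C1_Cdir E1 C1Y1).
have cge : continuous (grad_dot e Ye) by case: (C1_Cdir e C1Ye).
have cY1 := C1_cont C1Y1; have cYe := C1_cont C1Ye.
transitivity (seg e (- L) L (fun x => -1 * seg E1 0 L (grad_dot E1 Y1) x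
    + -1 * seg E1 0 L (grad_dot e Ye) x) y).
  apply: eq_seg => t _; apply: etrans (seg_lin E1 0 L (-1) (-1) _ cg1 cge).
  by apply: eq_seg => s _; have := div0 (y + t *: e + s *: E1); lra.
have c1 : continuous (seg E1 0 L (grad_dot E1 Y1)) by exact: seg_continuous.
have c2 : continuous (seg E1 0 L (grad_dot e Ye)) by exact: seg_continuous.
have A1 : seg e (- L) L (seg E1 0 L (grad_dot E1 Y1)) y = - seg e (- L) L Y1 y.
  rewrite -[RHS]mulN1r -(segZ e (- L) L (-1) y cY1); apply: eq_seg => t _.
  rewrite (seg_Cdir _ (C1_Cdir E1 C1Y1))//.
  rewrite (supp_shift sY1 E11) ?scale0r ?addr0 ?sub0r ?mulN1r//.
  by apply: far; rewrite !dE mulr0 addr0.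
have A2 : seg e (- L) L (seg E1 0 L (grad_dot e Ye)) y = 0.
  rewrite (seg_comm e E1 _ _ _ _ y cge); apply: seg_eq0 => s _.
  rewrite (seg_Cdir _ (C1_Cdir e C1Ye))//.
  have KL : K < L by move: K0 kapE LE => *; lra.
  by rewrite !(supp_shift sYe ee) ?subrr// !dE ey mulr0 !add0r ?normrN ger0_norm.
apply: etrans (seg_lin e (- L) L (-1) (-1) y c1 c2) _.
by rewrite A1 A2 mulr0 addr0 mulN1r opprK.
Qed.

Let stream_far2 z : K < `|dot E2 z| -> stream z = 0.
Proof.
move=> h; apply: seg_eq0 => t _; apply: seg_eq0 => s _; apply: (sY2 E22).
by rewrite !dE !(mulr0, addr0).
Qed.

(** Along E2, [stream] is constant at a distance larger than K from the line
    through the origin of direction e, and it vanishes when the half-plane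
    misses the support. *)
Let stream_far1 z : dot e z = 0 -> - (5 * kap) <= dot E1 z -> K < `|dot E1 z| ->
  stream z = 0.
Proof.
move=> ez h hK; pose U := `|dot E2 z| + kap.
have U0 : 0 <= U by rewrite addr_ge0// ltW.
have := seg_Cdir z stream_d2 U0; rewrite scale0r addr0 stream_far2; last first.
  rewrite !dE mulr1 ltr_normr; apply/orP; left.
  by have := ler_norm (- dot E2 z); rewrite normrN /U; move: K0 kapE => *; lra.
rewrite seg_eq0 => [/esym/eqP|t _]; first by rewrite sub0r oppr_eq0 => /eqP.
rewrite d2E ?dE ?mulr0 ?addr0//; apply: seg_eq0 => s _; apply: (sY1 E11).
by rewrite !dE !(mulr0, addr0).
Qed.

(** Independence of the half-plane: along nu the derivative of [stream] is minus
    the flux density across nu, so the flux through the half-plane on the side of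
    nu is a difference of two values of [stream], one of which is far away. *)
Let stream_eq0 y (c s : R) : dot e y = 0 -> `|dot E1 y| <= kap -> `|dot E2 y| <= kap ->
  c ^+ 2 + s ^+ 2 = 1 ->
  seg (c *: E1 + s *: E2) 0 T (seg e (- L) L (fun x => s * Y1 x - c * Y2 x)) y = 0 ->
  stream y = 0.
Proof.
move=> ey y1 y2 cs; set nu := _ + _ => I0.
have cY1 := C1_cont C1Y1; have cY2 := C1_cont C1Y2.
have c1 : `|c| <= 1.
  rewrite -(@ler_pXn2r _ 2%N)// ?nnegrE// expr1n real_normK ?num_real//.
  by rewrite -cs lerDl sqr_ge0.
have Dnu := Cdir_addv (Cdir_scale c stream_d1) (Cdir_scale s stream_d2).
have := seg_Cdir y Dnu T0; rewrite scale0r addr0 -/nu.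
have pos t : 0 <= t <= T -> - (5 * kap) <= dot E1 (y + t *: nu).
  move=> /andP[t0 tT]; rewrite /nu !dE mulr0 addr0 mulr1.
  have : `|t * c| <= T.
    by rewrite normrM (ger0_norm t0) -[T]mulr1 ler_pM.
  by move: y1; rewrite !ler_norml => /andP[? ?] /andP[? ?]; move: TE => *; lra.
have -> : seg nu 0 T (fun x => c * d1 x + s * d2 x) y = 0.
  apply: etrans I0; apply: eq_seg => t tT; rewrite d1E ?pos// d2E ?pos//; last first.
    by rewrite /nu !dE ey !(mulr0, addr0).
  apply: etrans (_ : seg e (- L) L (fun x => s * Y1 x + - c * Y2 x) (y + t *: nu) = _).
    apply/esym; apply: etrans (seg_lin e (- L) L s (- c) (y + t *: nu) cY1 cY2) _.
    by rewrite mulrN mulNr addrC.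
  by apply: eq_seg => u _; rewrite mulNr.
move/esym/eqP; rewrite subr_eq0 => /eqP <-.
have ez : dot e (y + T *: nu) = 0 by rewrite /nu !dE ey !(mulr0, addr0).
have zpos := pos T; rewrite lexx T0 in zpos; have {}zpos := zpos isT.
case: (ltP K `|dot E1 (y + T *: nu)|) => h1; first exact: stream_far1.
case: (ltP K `|dot E2 (y + T *: nu)|) => h2; first exact: stream_far2.
exfalso; move: h1 h2; rewrite /nu !dE !(mulr0, addr0) add0r !mulr1.
have half (a b : R) : `|a| <= kap -> `|a + T * b| <= K -> b ^+ 2 <= 2^-1 ^+ 2.
  move=> ha hb; rewrite -real_normK ?num_real// ler_pXn2r ?nnegrE//.
  move: ha hb; rewrite TE !ler_norml => /andP[? ?] /andP[? ?].
  have k2 := k0; have K1 := kapE.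
  have [bl bu] : - (2 * kap) <= 4 * kap * b /\ 4 * kap * b <= 2 * kap by split; lra.
  apply/andP; split; rewrite leNgt; apply/negP => bb.
    have : 0 < kap * (- 2^-1 - b) by rewrite mulr_gt0// subr_gt0.
    by rewrite mulrBr; lra.
  have : 0 < kap * (b - 2^-1) by rewrite mulr_gt0// subr_gt0.
  by rewrite mulrBr; lra.
move=> /(half _ _ y1) hc /(half _ _ y2) hs.
have : 1 <= 2^-1 ^+ 2 + 2^-1 ^+ 2 :> R by rewrite -[leLHS]cs lerD.
by apply/negP; rewrite -ltNge expr2; lra.
Qed.

(** If every line of direction e bounds some half-plane of zero flux, then
    [stream] vanishes, and with it its gradient, which is the field integrated
    along the lines of direction e. *)
Lemma flux_lines :
  (forall y, dot e y = 0 -> `|dot E1 y| <= kap -> `|dot E2 y| <= kap ->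
    exists c s : R, c ^+ 2 + s ^+ 2 = 1 /\
    seg (c *: E1 + s *: E2) 0 T (seg e (- L) L (fun x => s * Y1 x - c * Y2 x)) y = 0) ->
  forall y, dot e y = 0 -> seg e (- L) L Y1 y = 0 /\ seg e (- L) L Y2 y = 0.
Proof.
move=> H0 y ey.
have S0 z : dot e z = 0 -> `|dot E1 z| <= kap -> `|dot E2 z| <= kap -> stream z = 0.
  by move=> ez z1 z2; have [c [s [cs I0]]] := H0 z ez z1 z2; exact: stream_eq0 I0.
case: (ltP K `|dot E1 y|) => y1.
  by split; apply: seg_eq0 => t _; [apply: (sY1 E11)|apply: (sY2 E11)];
    rewrite !dE mulr0 addr0.
case: (ltP K `|dot E2 y|) => y2.
  by split; apply: seg_eq0 => t _; [apply: (sY1 E22)|apply: (sY2 E22)];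
    rewrite !dE mulr0 addr0.
have y1' : - (5 * kap) <= dot E1 y.
  by move: y1; rewrite ler_norml => /andP[? ?]; move: K0 kapE => *; lra.
have Kk : K <= kap by move: kapE => ->; rewrite lerDl.
have zero d (g : E3 -> R) : Cdir d stream g -> dot e d = 0 ->
    `|dot E1 d| <= 1 -> `|dot E2 d| <= 1 -> g y = 0.
  move=> C ed d11 d21; have D := Cdir_line y 0 C; rewrite scale0r addr0 in D.
  suff D0 : is_derive (0 : R) 1 (fun s : R => stream (y + s *: d)) 0.
    by rewrite -(@derive_val _ _ _ _ _ _ _ D) (@derive_val _ _ _ _ _ _ _ D0).
  have Dc := is_derive_cst (0 : R) (0 : R) 1.
  apply: near_eq_is_derive Dc.
  near=> h; have h1 : `|h| <= 1 by apply: ltW; near: h; exact: (@near0_lt1 R).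
  have bd (a b : R) : `|a| <= K -> `|b| <= 1 -> `|a + h * b| <= kap.
    move=> aK b1; rewrite kapE; apply: le_trans (ler_normD _ _) _.
    by apply: lerD => //; rewrite normrM mulr_ile1.
  by apply/esym/S0; rewrite !dE ?ed ?ey ?mulr0 ?addr0 ?bd.
have [g1 g2] : d1 y = 0 /\ d2 y = 0.
  split; [apply: (zero _ _ stream_d1)|apply: (zero _ _ stream_d2)];
    by rewrite ?E11 ?E21 ?E12 ?E22 ?normr0 ?normr1.
split; first by rewrite -d2E.
by move: g1; rewrite d1E// => /eqP; rewrite oppr_eq0 => /eqP.
Unshelve. all: by end_near. Qed.

End OneFrame.
End Flux.

(** The algebra behind [stress_div], on abstract components: contracting the
    Euler equation with e. *)
Lemma divergence_contract (R : comNzRingType) (e u q : 'I_3 -> R) (A : 'I_3 -> 'I_3 -> R) :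
  \sum_j \sum_k (j == k)%:R * ((\sum_i e i * u i) * A k j
    + u k * (\sum_l e l * A l j) + e k * q j) =
  \sum_k e k * (\sum_j (u k * A j j + u j * A k j) + q k).
Proof. by rewrite !sum3 /=; ring. Qed.

Section Euler.
Variable R : realType.
Local Notation E3 := 'rV[R]_3.
Implicit Types (x d e y n w : E3).

Variables (v : E3 -> E3) (p : E3 -> R) (K : R).
Hypothesis K0 : 0 < K.
Hypotheses (smv : forall i, smooth (component v i)) (smp : smooth p).
Hypotheses (sv : forall i, supp K (component v i)) (sp : supp K p).
Hypothesis euler : forall (i : 'I_3) x,
  \sum_(j < 3) partial j (fun y => component v i y * component v j y) x
    + partial i p x = 0.

Local Notation vc := (component v).

Let Cv i : C1 (vc i). Proof. exact: smooth_C1. Qed.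
Let Cp : C1 p. Proof. exact: smooth_C1. Qed.
Let cv i : continuous (vc i). Proof. exact: C1_cont. Qed.
Let cp : continuous p. Proof. exact: C1_cont. Qed.

Definition vdot d x := dot d (v x).

Lemma vdotE d x : vdot d x = \sum_i d ord0 i * vc i x.
Proof. by []. Qed.

Lemma vdot_C1 d : C1 (vdot d) /\
  forall i x, partial i (vdot d) x = \sum_j d ord0 j * partial i (vc j) x.
Proof.
have [C P] := C1_sum (fun j => (C1Z (d ord0 j) (Cv j)).1).
split=> // i x; have := P i x; rewrite /vdot /dot => ->.
by apply: eq_bigr => j _; rewrite (C1Z (d ord0 j) (Cv j)).2.
Qed.

Lemma vdot_supp d : supp K (vdot d).
Proof. by apply: supp_sum => i; apply: suppZ; exact: sv. Qed.

Lemma euler_expand i x :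
  \sum_j (vc i x * partial j (vc j) x + vc j x * partial j (vc i) x)
    + partial i p x = 0.
Proof.
rewrite -[RHS](euler i x); congr (_ + _); apply: eq_bigr => j _.
by rewrite (C1M (Cv i) (Cv j)).2.
Qed.

(** The component along d of T e, where T = v (x) v + p I. *)
Definition stress e d x := vdot e x * vdot d x + dot e d * p x.

Lemma stress_C1 e d : C1 (stress e d) /\ forall i x, partial i (stress e d) x =
  vdot e x * partial i (vdot d) x + vdot d x * partial i (vdot e) x
    + dot e d * partial i p x.
Proof.
have [C P] := C1D (C1M (vdot_C1 e).1 (vdot_C1 d).1).1 (C1Z (dot e d) Cp).1.
split=> // i x; rewrite [LHS]P (C1M (vdot_C1 e).1 (vdot_C1 d).1).2.
by rewrite (C1Z (dot e d) Cp).2.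
Qed.

Lemma stress_supp e d : supp K (stress e d).
Proof.
by apply: suppD; [apply: suppM; exact: vdot_supp|exact: suppZ].
Qed.

(** For fixed e, the field T e is free of divergence; completeness of the frame
    makes the divergence independent of it. *)
Lemma stress_div (F : 'I_3 -> E3) e x : orthonormal3 F ->
  \sum_i grad_dot (F i) (stress e (F i)) x = 0.
Proof.
move=> /orthonormal3_complete c.
pose t j k := vdot e x * partial j (vc k) x + vc k x * partial j (vdot e) x
  + e ord0 k * partial j p x.
transitivity (\sum_j \sum_k (\sum_i F i ord0 j * F i ord0 k) * t j k).
  have E i : grad_dot (F i) (stress e (F i)) x =
      \sum_j \sum_k F i ord0 j * F i ord0 k * t j k.
    apply: eq_bigr => j _; rewrite (stress_C1 e (F i)).2 (vdot_C1 (F i)).2.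
    by rewrite (vdotE (F i)) /dot /t !sum3; ring.
  under eq_bigr do rewrite E.
  rewrite exchange_big /=; apply: eq_bigr => j _.
  by rewrite exchange_big /=; apply: eq_bigr => k _; rewrite -mulr_suml.
under eq_bigr do under eq_bigr do rewrite c.
have E : \sum_k e ord0 k * (\sum_j (vc k x * partial j (vc j) x
    + vc j x * partial j (vc k) x) + partial k p x) = 0.
  by apply: big1 => k _; rewrite euler_expand mulr0.
rewrite -[RHS]E.
have := divergence_contract (fun i => e ord0 i) (fun i => vc i x)
  (fun j => partial j p x) (fun i j => partial j (vc i) x).
move=> <-; apply: eq_bigr => j _; apply: eq_bigr => k _.
by rewrite /t vdotE (vdot_C1 e).2.
Qed.

Section Flux.
Variable H : forall m : oriented_line R, half_plane m.
Hypothesis w0 : forall m, w v H m = 0.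

Variables kap L : R.
Hypotheses (kapE : kap = K + 1) (LE : L = 7 * kap).

(** The given half-plane at each line is arbitrary, and its inward vector nu and
    normal are turned by an angle that depends on the line with respect to the
    fixed frame; up to sign, the normal is s E1 - c E2 when nu = c E1 + s E2,
    and the sign does not affect the vanishing of the flux. *)
Lemma stress_lines_ray e y n : dot e e = 1 -> dot e y = 0 -> dot e n = 0 ->
  seg e (- L) L (fun x => vdot e x * vdot n x) y = 0.
Proof.
move=> ee ey en.
have z0 : dot (0 : E3) e = 0 by rewrite dot3 !mxE !mul0r !addr0.
pose h0 := H (OrientedLine ee z0).
pose E1 := inward h0; pose E2 := normal h0.
have E11 : dot E1 E1 = 1 by exact: inward_unit.
have E22 : dot E2 E2 = 1 by exact: normal_unit.
have eE1 : dot e E1 = 0 by rewrite dotC; exact: (inward_orth h0).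
have eE2 : dot e E2 = 0 by rewrite dotC; exact: (normal_orth_direction h0).
have E12 : dot E1 E2 = 0 by rewrite dotC; exact: (normal_orth_inward h0).
pose F (i : 'I_3) := nth 0 [:: e; E1; E2] i.
have oF : orthonormal3 F by exact: (half_plane_frame h0).
have ex a b : dot a b = dot e a * dot e b + dot E1 a * dot E1 b + dot E2 a * dot E2 b.
  by rewrite (orthonormal3_expand a b oF) sum3.
have div0 x : grad_dot e (stress e e) x + grad_dot E1 (stress e E1) x
    + grad_dot E2 (stress e E2) x = 0.
  by rewrite -(stress_div e x oF) sum3.
have S1 x : stress e E1 x = vdot e x * vdot E1 x by rewrite /stress eE1 mul0r addr0.
have S2 x : stress e E2 x = vdot e x * vdot E2 x by rewrite /stress eE2 mul0r addr0.
have Cen d : continuous (fun x => vdot e x * vdot d x).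
  by apply: contM; apply: C1_cont; exact: (vdot_C1 _).1.
have := @flux_lines R K e E1 E2 (stress e E1) (stress e E2) (stress e e) K0
  ee E11 E22 eE1 eE2 E12 (stress_C1 _ _).1 (stress_C1 _ _).1 (stress_C1 _ _).1
  (stress_supp _ _) (stress_supp _ _) (stress_supp _ _) div0 kap L (4 * kap)
  kapE LE erefl _ y ey.
case=> [{ey}y ey y1 y2|l1 l2]; last first.
  have nE x : vdot n x = dot n E1 * vdot E1 x + dot n E2 * vdot E2 x.
    by rewrite /vdot (ex n (v x)) en mul0r add0r !(dotC _ n).
  transitivity (seg e (- L) L (fun x => dot n E1 * stress e E1 x
      + dot n E2 * stress e E2 x) y).
    apply: eq_seg => t _; rewrite nE S1 S2.
    have AC (a b c d f : R) : a * (b * c + d * f) = b * (a * c) + d * (a * f) by ring.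
    exact: AC.
  apply: etrans (seg_lin e (- L) L _ _ y (C1_cont (stress_C1 _ _).1) (C1_cont (stress_C1 _ _).1)) _.
  by rewrite l1 l2 !mulr0 addr0.
have ye : dot y e = 0 by rewrite dotC.
pose m := OrientedLine ee ye; pose h := H m.
have nue : dot e (inward h) = 0 by rewrite dotC; exact: (inward_orth h).
have nne : dot e (normal h) = 0 by rewrite dotC; exact: (normal_orth_direction h).
pose c := dot E1 (inward h); pose s := dot E2 (inward h).
pose al := dot E1 (normal h); pose be := dot E2 (normal h).
have cs : c ^+ 2 + s ^+ 2 = 1.
  by have := inward_unit h; rewrite ex nue mulr0 add0r !expr2.
have ab : al ^+ 2 + be ^+ 2 = 1.
  by have := normal_unit h; rewrite ex nne mulr0 add0r !expr2.
have acbs : al * c + be * s = 0.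
  by have := normal_orth_inward h; rewrite ex nne mul0r add0r.
have nuE : inward h = c *: E1 + s *: E2.
  apply/rowP => i; rewrite -!(dot_delta i) ex nue mulr0 add0r dotDr !dotZr.
  by rewrite !(dotC E1 (delta R i)) !(dotC E2 (delta R i)) !(mulrC _ c) !(mulrC _ s).
pose k := al * s - be * c.
have alE : al = k * s.
  have -> : k * s = al * (c ^+ 2 + s ^+ 2) - c * (al * c + be * s) by rewrite /k; ring.
  by rewrite cs acbs mulr0 subr0 mulr1.
have beE : be = - k * c.
  have -> : - k * c = be * (c ^+ 2 + s ^+ 2) - s * (al * c + be * s) by rewrite /k; ring.
  by rewrite cs acbs mulr0 subr0 mulr1.
have k0 : k != 0.
  apply/eqP => k0; move: ab; rewrite alE beE k0 oppr0 !mul0r expr0n addr0 => /eqP.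
  by rewrite eq_sym oner_eq0.
exists c, s; split=> //.
have Kkap : K < kap by rewrite kapE ltrDl.
have kap0 : 0 < kap by exact: lt_trans Kkap.
have L0 : 0 <= L by rewrite LE mulr_ge0// ltW.
have sup : supp K (fun x => vdot e x * vdot (normal h) x).
  by apply: suppM; exact: vdot_supp.
have := w0 m; rewrite /w -/h => /eqP; rewrite oppr_eq0 => /eqP.
rewrite (@half_plane_seg R m h _ L (4 * kap)); last first.
- move=> a t t0 [La|Tt].
    apply: (sup _ _ ee).
    rewrite !dotDr !dotZr /= ee nue ey mulr0 addr0 add0r mulr1.
    by apply: lt_trans La; rewrite LE; lra.
  apply: (sup _ _ (inward_unit h)).
  rewrite !dotDr !dotZr /= (inward_unit h) (inward_orth h) mulr1 mulr0 addr0.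
  have c1 : `|c| <= 1.
    rewrite -(@ler_pXn2r _ 2%N)// ?nnegrE// expr1n real_normK ?num_real//.
    by rewrite -cs lerDl sqr_ge0.
  have s1 : `|s| <= 1.
    rewrite -(@ler_pXn2r _ 2%N)// ?nnegrE// expr1n real_normK ?num_real//.
    by rewrite -cs lerDr sqr_ge0.
  have : `|dot (inward h) y| <= 2 * kap.
    rewrite ex nue mul0r add0r -/c -/s.
    have := ler_normD (c * dot E1 y) (s * dot E2 y); rewrite !normrM.
    have : `|c| * `|dot E1 y| <= 1 * kap by apply: ler_pM.
    have : `|s| * `|dot E2 y| <= 1 * kap by apply: ler_pM.
    by lra.
  rewrite ler_norml => /andP[b1 b2]; rewrite ltr_normr; apply/orP; left.
  by lra.
- by rewrite mulr_ge0// ltW.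
- exact: L0.
- exact: Cen.
rewrite /= nuE => I0; apply: (mulfI k0); rewrite mulr0 -[RHS]I0.
have cS d : continuous (stress e d) := C1_cont (stress_C1 e d).1.
have cst : continuous (fun x => s * stress e E1 x - c * stress e E2 x).
  by apply: contD; [exact: contZ|exact/contN/contZ].
have LL : - L <= L by lra.
rewrite -(segZ (c *: E1 + s *: E2) 0 (4 * kap) k y (seg_continuous (d := e) LL cst)).
apply: eq_seg => t _; rewrite -(segZ e (- L) L k _ cst); apply: eq_seg => a _.
set x := _ + a *: e.
have -> : dot (normal h) (v x) = al * vdot E1 x + be * vdot E2 x.
  by rewrite ex nne mul0r add0r.
rewrite S1 S2 alE beE -/(vdot e x).
have AC2 (a1 b1 c1 k1 c2 d1 : R) : k1 * (c1 * (a1 * b1) - c2 * (a1 * d1)) =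
  a1 * (k1 * c1 * b1 + - k1 * c2 * d1) by ring.
exact: AC2.
Qed.

End Flux.

End Euler.

(** * Pointwise consequences of the compatibility condition *)

Section Pointwise.
Variable R : realType.

Variables (v P : 'I_3 -> R) (A : 'I_3 -> 'I_3 -> R).

(* A i j stands for the derivative of v i along axis j, P for the gradient of p. *)
Let u i := \sum_j A i j * v j.
Let V := \sum_i v i ^+ 2.
Let sig := \sum_i u i * v i.
Let b k := \sum_l v l * A l k + 2^-1 * P k.

Hypothesis codazzi : forall i j k,
  v i * A j k + v j * A i k - (i == j)%:R * b k =
  v k * A j i + v j * A k i - (k == j)%:R * b i.
Hypothesis euler : forall i, \sum_j (v i * A j j + v j * A i j) + P i = 0.
Hypothesis incompressible : \sum_j A j j = 0.

(** Contract the compatibility condition with v over the index k. *)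
Lemma gradient_formula i j :
  V * A j i = v i * u j + 2^-1 * (v j * u i) - (i == j)%:R * (2^-1 * sig).
Proof.
have Pu k : P k = - u k.
  have := euler k; move: incompressible; rewrite /u !sum3 => h e.
  have : v k * (A i0 i0 + A i1 i1 + A i2 i2) = 0 by rewrite h mulr0.
  by lra.
have bE k : b k = \sum_l v l * A l k - 2^-1 * u k by rewrite /b Pu mulrN.
have bv : \sum_k b k * v k = 2^-1 * sig.
  rewrite /sig; under eq_bigr do rewrite bE.
  by rewrite /u !sum3; field.
have S : \sum_k v k * (v i * A j k + v j * A i k - (i == j)%:R * b k) =
         \sum_k v k * (v k * A j i + v j * A k i - (k == j)%:R * b i).
  by apply: eq_bigr => k _; rewrite codazzi.
have D : \sum_k v k * (k == j)%:R = v j.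
  move: j {S}; apply: ord3P; rewrite sum3 /=; ring.
have L : \sum_k v k * (v i * A j k + v j * A i k - (i == j)%:R * b k) =
    v i * u j + v j * u i - (i == j)%:R * \sum_k b k * v k.
  by rewrite /u !sum3; ring.
have Rr : \sum_k v k * (v k * A j i + v j * A k i - (k == j)%:R * b i) =
    V * A j i + v j * (\sum_l v l * A l i) - (\sum_k v k * (k == j)%:R) * b i.
  by rewrite /V !sum3; ring.
move: S; rewrite L Rr D bv bE; lra.
Qed.

Lemma gradient_trace :
  V ^+ 2 * \sum_i \sum_j A i j * A j i = 2^-1 * sig ^+ 2 + V * \sum_i u i ^+ 2.
Proof.
have -> : V ^+ 2 * \sum_i \sum_j A i j * A j i =
    \sum_i \sum_j (V * A i j) * (V * A j i) by rewrite !sum3; ring.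
under eq_bigr do under eq_bigr do rewrite !gradient_formula.
by rewrite /sig /V !sum3 /=; field.
Qed.

End Pointwise.

(** * The compatibility condition and the vanishing of the flow *)

(** A quadratic form m which is diagonal, with equal entries, on the orthogonal
    of the first frame vector, and for which that vector is an eigenvector of
    eigenvalue - q, is determined by q and one more number. *)
Lemma isotropic_moment (R : realType) (F m : 'I_3 -> 'I_3 -> R) (q : R) :
  (forall a b, \sum_k F a k * F b k = (a == b)%:R) ->
  (forall j k, \sum_a F a j * F a k = (j == k)%:R) ->
  (forall i, \sum_j F i0 j * m i j + F i0 i * q = 0) ->
  (forall i j, m i j = m j i) ->
  let M a b := \sum_k \sum_l F a k * F b l * m k l in
  M i1 i2 = 0 -> M i1 i1 = M i2 i2 ->
  forall i j, m i j = (i == j)%:R * M i1 i1 - (q + M i1 i1) * (F i0 i * F i0 j).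
Proof.
move=> ortho compl eul sym M M12 M1122 i j.
have MC a b : M a b = M b a.
  rewrite /M exchange_big; apply: eq_bigr => k _; apply: eq_bigr => l _.
  by rewrite (sym l k) (mulrC (F a l)).
have M0 b : M i0 b = - q * (b == i0)%:R.
  have E : \sum_l F b l * (\sum_k F i0 k * m l k + F i0 l * q) = 0.
    by apply: big1 => l _; rewrite eul mulr0.
  rewrite -ortho; apply/eqP; rewrite -subr_eq0 -[X in _ == X]E; apply/eqP.
  rewrite /M !sum3 (sym i1 i0) (sym i2 i0) (sym i2 i1); ring.
have mE : m i j = \sum_a \sum_b F a i * F b j * M a b.
  transitivity (\sum_k \sum_l (\sum_a F a i * F a k) * (\sum_b F b j * F b l) * m k l).
    under eq_bigr do under eq_bigr do rewrite !compl.
    move: i j; apply: ord3P; apply: ord3P; rewrite !sum3 /=; ring.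
  rewrite /M !sum3; ring.
rewrite mE -(compl i j) !sum3 !M0 !(MC _ i0) !M0 (MC i2 i1) M12 -M1122 /=; ring.
Qed.

Lemma bilinear_rotation (R : realFieldType) (f1 f2 : 'I_3 -> R) (m : 'I_3 -> 'I_3 -> R) :
  let M (a b : 'I_3 -> R) := \sum_i \sum_j a i * b j * m i j in
  M (fun i => 3 / 5 * f1 i + 4 / 5 * f2 i) (fun i => 4 / 5 * f1 i + - (3 / 5) * f2 i) =
  12 / 25 * (M f1 f1 - M f2 f2) + 16 / 25 * M f2 f1 - 9 / 25 * M f1 f2.
Proof. by rewrite /= !sum3; field. Qed.

(** Here K bounds both the support and the half-length from which line integrals
    are known to vanish. *)
Section Codazzi.
Variable R : realType.
Local Notation E3 := 'rV[R]_3.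
Implicit Types (x d e y n w : E3).

Variables (v : E3 -> E3) (p : E3 -> R) (K B : R).
Hypotheses (K0 : 0 < K) (KB : K < B).
Hypotheses (smv : forall i, smooth (component v i)) (smp : smooth p).
Hypotheses (sv : forall i, supp K (component v i)) (sp : supp K p).
Hypothesis euler : forall (i : 'I_3) x,
  \sum_(j < 3) partial j (fun y => component v i y * component v j y) x
    + partial i p x = 0.
Hypothesis divv : forall x, divergence v x = 0.
Hypothesis ray : forall e y n (L : R), dot e e = 1 -> dot e y = 0 ->
  dot e n = 0 -> K <= L -> seg e (- L) L (fun x => vdot v e x * vdot v n x) y = 0.
Hypothesis frame : forall e, dot e e = 1 ->
  exists F : 'I_3 -> E3, orthonormal3 F /\ F i0 = e.

Local Notation vc := (component v).

Let Cv i : C1 (vc i). Proof. exact: smooth_C1. Qed.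
Let Cp : C1 p. Proof. exact: smooth_C1. Qed.
Let cv i : continuous (vc i). Proof. exact: C1_cont. Qed.
Let cp : continuous p. Proof. exact: C1_cont. Qed.
Let B0 : 0 < B. Proof. exact: lt_trans KB. Qed.
Let Cvd d : C1 (vdot v d). Proof. exact: (vdot_C1 smv d).1. Qed.

(** When w is orthogonal to e, the ridge function is constant along the lines of
    direction e. *)
Lemma ridge_moment0 e n w k : dot e e = 1 -> dot e n = 0 -> dot e w = 0 ->
  cube B (fun x => vdot v e x * vdot v n x * dot w x ^+ k) = 0.
Proof.
move=> ee en ew.
have Cen : C1 (fun x => vdot v e x * vdot v n x) by exact: (C1M (Cvd e) (Cvd n)).1.
apply: (cube_lines (f := fun x => vdot v e x * vdot v n x * dot w x ^+ k) (e := e) (K := K)) => //.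
- by rewrite K0.
- exact: (C1M Cen (C1_pow w k)).1.
- by do 2 apply: suppM; exact: vdot_supp.
move=> y L ey KL.
transitivity (seg e (- L) L (fun x => dot w y ^+ k * (vdot v e x * vdot v n x)) y).
  by apply: eq_seg => t _; rewrite dotDr dotZr (dotC w e) ew mulr0 addr0 mulrC.
by rewrite (segZ e (- L) L _ y (C1_cont Cen)) ray// mulr0.
Qed.

Section FixedRidge.
Variables (w : E3) (k : nat).
Let m i j := cube B (fun x => vc i x * vc j x * dot w x ^+ k).
Let q := cube B (fun x => p x * dot w x ^+ k).

Let cm i j : continuous (fun x => vc i x * vc j x * dot w x ^+ k).
Proof. by apply: contM; [exact: contM|exact: pow_continuous]. Qed.

Lemma moment_bilinear a b : cube B (fun x => vdot v a x * vdot v b x * dot w x ^+ k) =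
  \sum_i \sum_j a ord0 i * b ord0 j * m i j.
Proof.
transitivity (cube B (fun x => \sum_i \sum_j (a ord0 i * b ord0 j) *
    (vc i x * vc j x * dot w x ^+ k))).
  apply: eq_cube => x _; rewrite /vdot /dot !mulr_suml; apply: eq_bigr => i _.
  rewrite mulr_sumr mulr_suml; apply: eq_bigr => j _.
  have AC (a1 b1 c d f : R) : a1 * b1 * (c * d) * f = a1 * c * (b1 * d * f) by ring.
  exact: AC.
rewrite (cube_sum B0); last by move=> i; apply: cont_sum => j; exact: contZ.
apply: eq_bigr => i _; rewrite (cube_sum B0); last by move=> j; exact: contZ.
by apply: eq_bigr => j _; rewrite (cubeZ B0).
Qed.

(** The Euler equation, tested against the ridge polynomial of degree k + 1. *)
Lemma moment_euler i : \sum_j w ord0 j * m i j + w ord0 i * q = 0.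
Proof.
have CM j : C1 (fun x => vc i x * vc j x) by exact: (C1M (Cv i) (Cv j)).1.
have sM j : supp K (fun x => vc i x * vc j x) by exact: suppM.
pose f j x := partial j (fun y => vc i y * vc j y) x * dot w x ^+ k.+1.
have cf j : continuous (f j).
  by apply: contM; [case: (CM j j)|exact: pow_continuous].
have cq : continuous (fun x => partial i p x * dot w x ^+ k.+1).
  by apply: contM; [case: (Cp i)|exact: pow_continuous].
have : cube B (fun x => \sum_j f j x + partial i p x * dot w x ^+ k.+1) = 0.
  rewrite -[RHS](cube0 B); apply: eq_cube => x _.
  by rewrite -mulr_suml -mulrDl euler mul0r.
have cfs : continuous (fun x => \sum_j f j x) by exact: cont_sum.
rewrite (cubeD B0 cfs cq) (cube_sum B0 _ cf).
have E j : cube B (f j) = - (k.+1%:R * w ord0 j * m i j).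
  by rewrite /f (cube_ibp_pow K0 KB j w k (CM j) (sM j)).
rewrite (eq_bigr _ (fun j _ => E j)) (cube_ibp_pow K0 KB i w k Cp sp) -/q.
rewrite sumrN -opprD => /eqP; rewrite oppr_eq0.
under eq_bigr do rewrite -mulrA.
rewrite -mulr_sumr -[k.+1%:R * _ * q]mulrA -mulrDr mulf_eq0 pnatr_eq0 /=.
by move/eqP.
Qed.

(** The off-diagonal moments vanish in every orthonormal frame of the plane
    orthogonal to w, so the restriction of m to this plane is scalar. *)
Lemma moment_unit : dot w w = 1 -> exists beta, forall i j,
  m i j = (i == j)%:R * beta - (q + beta) * (w ord0 i * w ord0 j).
Proof.
move=> /frame[F [oF F0]].
pose M a b := \sum_i \sum_j F a ord0 i * F b ord0 j * m i j.
have ME a b : M a b = cube B (fun x => vdot v (F a) x * vdot v (F b) x * dot w x ^+ k).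
  by rewrite moment_bilinear.
have Fw : dot (F i1) w = 0 /\ dot (F i2) w = 0 by rewrite -F0 !oF.
have M12 : M i1 i2 = 0 by rewrite ME ridge_moment0 ?oF//; case: Fw.
have sym i j : m i j = m j i.
  by apply: eq_cube => x _; rewrite (mulrC (vc i x)).
have M21 : M i2 i1 = 0 by rewrite ME ridge_moment0 ?oF//; case: Fw.
(* A rational rotation of the frame by the angle of tangent 4/3. *)
have M11 : M i1 i1 = M i2 i2.
  pose e := 3 / 5 *: F i1 + 4 / 5 *: F i2; pose n := 4 / 5 *: F i1 + - (3 / 5) *: F i2.
  have : \sum_i \sum_j e ord0 i * n ord0 j * m i j = 0.
    rewrite -moment_bilinear ridge_moment0 //;
      rewrite /e /n !(dotDr, dotDl, dotZl, dotZr) ?oF /=; try (case: Fw => -> ->); by field.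
  have -> : \sum_i \sum_j e ord0 i * n ord0 j * m i j =
      12 / 25 * (M i1 i1 - M i2 i2) + 16 / 25 * M i2 i1 - 9 / 25 * M i1 i2.
    rewrite -(bilinear_rotation (fun i => F i1 ord0 i) (fun i => F i2 ord0 i) m).
    by apply: eq_bigr => i _; apply: eq_bigr => j _; rewrite !mxE.
  by rewrite M12 M21; lra.
exists (M i1 i1) => i j.
have := @isotropic_moment R (fun a k => F a ord0 k) m q oF
  (orthonormal3_complete oF) _ sym M12 M11 i j.
by rewrite F0; apply; exact: moment_euler.
Qed.

End FixedRidge.

(** Half the trace of v (x) v plus half the pressure: subtracting this multiple
    of the identity cancels the scalar part of the moments, because of the Euler
    equation. *)
Definition half_trace x := 2^-1 * (\sum_l vc l x * vc l x + p x).

(** The momentum tensor v (x) v, corrected so that it has the moments of the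
    Hessian of a function. *)
Definition hess_tensor (i j : 'I_3) x := vc i x * vc j x + - (i == j)%:R * half_trace x.

Lemma half_trace_C1 : C1 half_trace /\ forall k x, partial k half_trace x =
  \sum_l vc l x * partial k (vc l) x + 2^-1 * partial k p x.
Proof.
have Cs := C1_sum (fun l => (C1M (Cv l) (Cv l)).1).
have Cd := C1D Cs.1 Cp; have CZ := C1Z 2^-1 Cd.1; split; first exact: CZ.1.
by move=> k x; rewrite [LHS]CZ.2 Cd.2 Cs.2 !sum3 !(C1M (Cv _) (Cv _)).2; field.
Qed.

Lemma hess_tensor_C1 i j : C1 (hess_tensor i j) /\ forall k x, partial k (hess_tensor i j) x =
  vc i x * partial k (vc j) x + vc j x * partial k (vc i) x
    - (i == j)%:R * partial k half_trace x.
Proof.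
have CM := C1M (Cv i) (Cv j); have CZ := C1Z (- (i == j)%:R) half_trace_C1.1.
have CD := C1D CM.1 CZ.1; split; first exact: CD.1.
by move=> k x; rewrite [LHS]CD.2 CM.2 CZ.2 mulNr.
Qed.

Lemma hess_tensor_supp i j : supp K (hess_tensor i j).
Proof.
apply: suppD; first exact: suppM.
by apply/suppZ/suppZ/suppD => //; apply: supp_sum => l; exact: suppM.
Qed.

(** A Hessian integrated twice by parts against a function of dot w x gives a
    multiple of w (x) w, whence the form of the moments. *)
Lemma hess_tensor_moment w k : dot w w = 1 -> exists g, forall i j,
  cube B (fun x => hess_tensor i j x * dot w x ^+ k) = g * (w ord0 i * w ord0 j).
Proof.
move=> ww; have [beta mE] := moment_unit k ww.
set q := cube B (fun x => p x * dot w x ^+ k) in mE.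
exists (- (q + beta)) => a b.
have cpw := @pow_continuous R w k.
have cvv i' j' : continuous (fun x => vc i' x * vc j' x * dot w x ^+ k).
  by apply: contM => //; exact: contM.
have cpp : continuous (fun x => p x * dot w x ^+ k) by exact: contM.
pose h x := \sum_l vc l x * vc l x * dot w x ^+ k + p x * dot w x ^+ k.
have ch : continuous h by apply: contD => //; exact: cont_sum.
transitivity (cube B (fun x => vc a x * vc b x * dot w x ^+ k +
    (- (a == b)%:R * 2^-1) * h x)).
  apply: eq_cube => x _; rewrite /hess_tensor /half_trace /h -mulr_suml.
  set s := \sum_l _; set z := dot w x ^+ k.
  have AC (a1 b1 c1 s1 p1 z1 : R) :
    (a1 + c1 * (b1 * (s1 + p1))) * z1 = a1 * z1 + c1 * b1 * (s1 * z1 + p1 * z1).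
    by ring.
  exact: AC.
rewrite (cubeD B0 (cvv a b) (contZ (k := _) ch)) (cubeZ B0 _ ch).
have -> : cube B h = 2 * beta.
  have cs : continuous (fun x => \sum_l vc l x * vc l x * dot w x ^+ k) by exact: cont_sum.
  rewrite /h (cubeD B0 cs cpp) -/q.
  rewrite (cube_sum B0 _ (fun l => cvv l l)).
  rewrite (eq_bigr _ (fun l _ => mE l l)) sum3 !eqxx.
  transitivity (3 * beta - (q + beta) * dot w w + q); last by rewrite ww; ring.
  by rewrite dot3 /=; ring.
by rewrite mE; field.
Qed.

(** After integration by parts, the symmetry in i and k is that of
    w_i w_j w_k. *)
Lemma compat_moment i j k w (N : nat) :
  cube B (fun x => (partial k (hess_tensor i j) x - partial i (hess_tensor k j) x) * dot w x ^+ N) = 0.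
Proof.
have C1S a b := (hess_tensor_C1 a b).1.
have cS a b : continuous (hess_tensor a b) by exact: C1_cont.
have cdS a b c : continuous (partial c (hess_tensor a b)) by case: (C1S a b c).
have cdP a b c (u : E3) l : continuous (fun x => partial c (hess_tensor a b) x * dot u x ^+ l).
  by apply: contM => //; exact: pow_continuous.
have split_cube u l : cube B (fun x =>
      (partial k (hess_tensor i j) x - partial i (hess_tensor k j) x) * dot u x ^+ l) =
    cube B (fun x => partial k (hess_tensor i j) x * dot u x ^+ l) -
    cube B (fun x => partial i (hess_tensor k j) x * dot u x ^+ l).
  rewrite -(cubeB B0 (cdP i j k u l) (cdP k j i u l)).
  by apply: eq_cube => x _; rewrite mulrBl.
have zeroth u : cube B (fun x =>
    (partial k (hess_tensor i j) x - partial i (hess_tensor k j) x) * dot u x ^+ 0) = 0.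
  rewrite split_cube.
  have E a b c : cube B (fun x => partial c (hess_tensor a b) x * dot u x ^+ 0) = 0.
    rewrite -[RHS](cube_partial0 K0 KB c (C1S a b) (@hess_tensor_supp a b)).
    by apply: eq_cube => x _; rewrite expr0 mulr1.
  by rewrite !E subrr.
case: N => [|n]; first exact: zeroth.
have [w0|w0] := eqVneq (dot w w) 0.
  have wi l : w ord0 l = 0.
    by apply/eqP; rewrite -sqrf_eq0 eq_le sqr_ge0 -w0 coord_sqr_le.
  rewrite -[RHS](cube0 B); apply: eq_cube => x _.
  by rewrite dot3 !wi !mul0r !addr0 expr0n mulr0.
pose r := Num.sqrt (dot w w).
have r0 : r != 0 by rewrite sqrtr_eq0 -ltNge lt_neqAle eq_sym w0 dot_sqr_ge0.
pose u := r^-1 *: w.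
have uu : dot u u = 1.
  by rewrite dotZl dotZr mulrA -expr2 exprVn sqr_sqrtr ?dot_sqr_ge0// mulVf.
have wE : w = r *: u by rewrite scalerA divff// scale1r.
have [g gE] := hess_tensor_moment n uu.
transitivity (cube B (fun x => r ^+ n.+1 *
    ((partial k (hess_tensor i j) x - partial i (hess_tensor k j) x) * dot u x ^+ n.+1))).
  by apply: eq_cube => x _; rewrite wE dotZl exprMn mulrCA.
rewrite (cubeZ B0); last first.
  by apply: contM; [apply: contD => //; exact: contN|exact: pow_continuous].
rewrite split_cube !(cube_ibp_pow K0 KB _ u n (C1S _ _) (@hess_tensor_supp _ _)) !gE.
set a := u ord0 i; set b := u ord0 j; set c := u ord0 k; set z := n.+1%:R.
have AC (r1 z1 a1 b1 c1 g1 : R) :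
    r1 * (- (z1 * c1 * (g1 * (a1 * b1))) - - (z1 * a1 * (g1 * (c1 * b1)))) = 0.
  by ring.
exact: AC.
Qed.

(** The Saint-Venant type compatibility condition. *)
Lemma codazzi i j k x : partial k (hess_tensor i j) x = partial i (hess_tensor k j) x.
Proof.
have C1S a b := (hess_tensor_C1 a b).1.
have cdS a b c : continuous (partial c (hess_tensor a b)) by case: (C1S a b c).
apply/eqP; rewrite -subr_eq0; apply/eqP.
apply: (ridge_eq0 (B := B) (K := K)
  (g := fun x => partial k (hess_tensor i j) x - partial i (hess_tensor k j) x)).
- by rewrite K0.
- by apply: contD => //; exact: contN.
- move=> y d d1 h.
  by rewrite !(supp_partial _ (@hess_tensor_supp _ _) d1 h) subrr.
- by move=> w N; exact: compat_moment.
Qed.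

(** The trace of the square of the gradient of v, which is minus the Laplacian
    of the pressure. *)
Definition grad_trace x := \sum_i \sum_j partial j (vc i) x * partial i (vc j) x.

Lemma grad_trace_continuous : continuous grad_trace.
Proof.
have c i j : continuous (partial j (vc i)) by case: (Cv i j).
by apply: cont_sum => i; apply: cont_sum => j; exact: contM.
Qed.

(** The function is a divergence, as div v = 0. *)
Lemma cube_grad_trace : cube B grad_trace = 0.
Proof.
have C2 i j : C1 (partial j (vc i)) by apply: smooth_C1; exact: smooth_partial.
have c1 i j : continuous (partial j (vc i)) by exact: C1_cont.
have c2 i j k : continuous (partial k (partial j (vc i))) by case: (C2 i j k).
have cij i j : continuous (fun x => partial j (vc i) x * partial i (vc j) x) by exact: contM.
have cij2 i j : continuous (fun x => vc i x * partial j (partial i (vc j)) x) by exact: contM.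
rewrite (cube_sum B0); last by move=> i; exact: cont_sum.
apply: big1 => i _; rewrite (cube_sum B0 _ (cij i)).
rewrite (eq_bigr _ (fun j _ => cube_ibp K0 KB j (Cv i) (C2 j i) (sv i))).
rewrite sumrN -(cube_sum B0 _ (cij2 i)); apply/eqP; rewrite oppr_eq0; apply/eqP.
rewrite -[RHS](cube0 B); apply: eq_cube => x _; rewrite -mulr_sumr.
rewrite (eq_bigr (fun j => partial i (partial j (vc j)) x)); last first.
  by move=> j _; apply: partial_comm.
have [Cs Ps] := C1_sum (fun j => C2 j j).
rewrite -Ps (_ : (fun y => \sum_j partial j (vc j) y) = fun=> 0).
  by rewrite (C1_cst (0 : R)).2 mulr0.
by apply/funext => y; exact: divv.
Qed.

Let sqn x := \sum_i vc i x ^+ 2.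
Let flow i x := \sum_j partial j (vc i) x * vc j x.

Let pointwise x : (forall i j, sqn x * partial i (vc j) x =
    vc i x * flow j x + 2^-1 * (vc j x * flow i x)
      - (i == j)%:R * (2^-1 * \sum_i flow i x * vc i x)) /\
  sqn x ^+ 2 * grad_trace x = 2^-1 * (\sum_i flow i x * vc i x) ^+ 2
    + sqn x * \sum_i flow i x ^+ 2.
Proof.
have cod i j k : vc i x * partial k (vc j) x + vc j x * partial k (vc i) x
   - (i == j)%:R * (\sum_l vc l x * partial k (vc l) x + 2^-1 * partial k p x) =
   vc k x * partial i (vc j) x + vc j x * partial i (vc k) x
   - (k == j)%:R * (\sum_l vc l x * partial i (vc l) x + 2^-1 * partial i p x).
  by have := codazzi i j k x; rewrite !(hess_tensor_C1 _ _).2 !half_trace_C1.2.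
have eul i : \sum_j (vc i x * partial j (vc j) x + vc j x * partial j (vc i) x)
    + partial i p x = 0 by exact: euler_expand.
split=> [i j|].
  exact: (gradient_formula (v := fun i => vc i x) (P := fun i => partial i p x)
    (A := fun i j => partial j (vc i) x) cod eul (divv x)).
exact: (gradient_trace (v := fun i => vc i x) (P := fun i => partial i p x)
    (A := fun i j => partial j (vc i) x) cod eul (divv x)).
Qed.

Let sqn_ge0 x : 0 <= sqn x. Proof. by apply: sumr_ge0 => i _; exact: sqr_ge0. Qed.

Let sqn_eq0 x : sqn x = 0 -> forall i, vc i x = 0.
Proof.
move=> /eqP; rewrite psumr_eq0 => [/allP h i|i _]; last exact: sqr_ge0.
by have := h i (mem_index_enum i); rewrite sqrf_eq0 => /eqP.
Qed.

(** [gradient_trace] gives the sign where v is not zero. A point where the value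
    is negative would therefore have a neighbourhood on which v = 0, and there
    the gradient vanishes too. *)
Lemma grad_trace_ge0 x : 0 <= grad_trace x.
Proof.
rewrite leNgt; apply/negP => tx.
have near_neg : \forall y \near x, grad_trace y < 0.
  by apply: cvgr_lt (@grad_trace_continuous x) _ _.
have near0 : \forall y \near x, sqn y = 0.
  apply: filterS near_neg => y ty; apply/eqP; rewrite eq_le sqn_ge0 andbT leNgt.
  apply/negP => sy; have [_] := pointwise y; apply/eqP; rewrite lt_eqF//.
  apply: (@lt_le_trans _ _ 0); first by rewrite pmulr_rlt0// exprn_gt0.
  rewrite addr_ge0// mulr_ge0 ?sqr_ge0 ?invr_ge0//.
  by apply: sumr_ge0 => i _; exact: sqr_ge0.
have A0 i j : partial j (vc i) x = 0.
  by apply: partial_near0; apply: filterS near0 => y /sqn_eq0.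
by move: tx; rewrite /grad_trace big1 ?ltxx// => i _; rewrite big1// => j _; rewrite A0 mul0r.
Qed.

Lemma grad_trace_eq0 x : grad_trace x = 0.
Proof.
have [xB|] := pselect (forall i, `|x ord0 i| < B); last first.
  move=> /existsNP[i /negP]; rewrite -leNgt => xi.
  have Kx : K < `|dot (delta R i) x| by rewrite dot_delta (lt_le_trans KB).
  rewrite /grad_trace big1// => a _; rewrite big1// => b _.
  by rewrite (supp_partial _ (sv a) (delta_unit R i) Kx) mul0r.
apply/eqP; rewrite eq_le grad_trace_ge0 andbT leNgt; apply/negP => tx.
have := cube_gt0 B0 grad_trace_continuous grad_trace_ge0 xB tx.
by rewrite cube_grad_trace ltxx.
Qed.

Lemma flow_eq0 i x : flow i x = 0.
Proof.
have [s0|s0] := eqVneq (sqn x) 0.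
  by apply: big1 => j _; rewrite (sqn_eq0 s0) mulr0.
have [_] := pointwise x; rewrite grad_trace_eq0 mulr0 => /esym/eqP.
have sp' : 0 < sqn x by rewrite lt_neqAle eq_sym s0 sqn_ge0.
have f0 : 0 <= \sum_i flow i x ^+ 2 by apply: sumr_ge0 => j _; exact: sqr_ge0.
have h1 : 0 <= 2^-1 * (\sum_i flow i x * vc i x) ^+ 2.
  by rewrite mulr_ge0 ?invr_ge0 ?sqr_ge0.
rewrite (paddr_eq0 h1 (mulr_ge0 (ltW sp') f0)).
move=> /andP[_]; rewrite mulf_eq0 (negbTE s0) /= => h.
move: h; rewrite psumr_eq0 => [/allP h|j _]; last exact: sqr_ge0.
by have := h i (mem_index_enum i); rewrite sqrf_eq0 => /eqP.
Qed.

Lemma pressure_eq0 x : p x = 0.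
Proof.
apply: (const_supp Cp sp) => {}x.
have := euler_expand smv euler i0 x; rewrite big_split /= -mulr_sumr.
have -> : \sum_i vc i x * partial i (vc i0) x = 0.
  by rewrite -[RHS](flow_eq0 i0 x); apply: eq_bigr => j _; rewrite mulrC.
by rewrite -/(divergence v x) divv mulr0 !add0r.
Qed.

(** With zero acceleration, [gradient_formula] gives |v|^2 grad v = 0, so |v|^4
    has zero gradient. *)
Lemma velocity_eq0 i x : vc i x = 0.
Proof.
have Cq := C1_sum (fun j => (C1M (Cv j) (Cv j)).1).
pose s y := \sum_j vc j y * vc j y.
have sE y : s y = sqn y by apply: eq_bigr => j _; rewrite expr2.
have Cs2 := C1M Cq.1 Cq.1.
have ss : supp K (fun y => s y * s y).
  by apply: suppM; apply: supp_sum => j; exact: suppM.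
apply: sqn_eq0; apply/eqP; rewrite -sE -sqrf_eq0 expr2; apply/eqP.
apply: (const_supp Cs2.1 ss) => y; rewrite Cs2.2 Cq.2 -/(s y) sE.
rewrite (_ : sqn y * _ = 0) ?addr0// mulr_sumr big1// => j _.
rewrite (C1M (Cv j) (Cv j)).2.
have A0 : sqn y * partial i0 (vc j) y = 0.
  have [-> _] := pointwise y; rewrite !flow_eq0 !mulr0 big1 ?mulr0 ?addr0 ?subr0//.
  by move=> l _; rewrite flow_eq0 mul0r.
by rewrite mulrDr mulrCA A0 mulr0 addr0.
Qed.

End Codazzi.

(** * The theorem *)

Theorem theorem6p1 (R : realType)
    (v : 'rV[R]_3 -> 'rV[R]_3) (p : 'rV[R]_3 -> R)
    (hv : test_field v) (hp : test_function p)
    (heuler : forall (i : 'I_3) (x : 'rV[R]_3),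
      \sum_(j < 3) partial j (fun y => component v i y * component v j y) x
        + partial i p x = 0)
    (hdiv : forall x : 'rV[R]_3, divergence v x = 0)
    (H : forall m : oriented_line R, half_plane m)
    (hw : forall m : oriented_line R, w v H m = 0) :
  (forall x : 'rV[R]_3, v x = 0) /\ (forall x : 'rV[R]_3, p x = 0).
Proof.
have smv i : smooth (component v i) by case: (hv i).
have [smp cpp] := hp.
have [Kp Kp0 sp] := compact_supp cpp.
have [a0 a00 s0] := compact_supp (hv i0).2.
have [a1 a10 s1] := compact_supp (hv i1).2.
have [a2 a20 s2] := compact_supp (hv i2).2.
pose K := Kp + a0 + a1 + a2.
have K0 : 0 < K by rewrite !addr_gt0.
have sv : forall i, supp K (component v i).
  by apply: ord3P; [apply: supp_le s0|apply: supp_le s1|apply: supp_le s2];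
    rewrite /K; lra.
have spK : supp K p by apply: supp_le sp; rewrite /K; lra.
pose kap := K + 1; pose L := 7 * kap.
have KL : K < L by rewrite /L /kap; lra.
have L0 : 0 < L by exact: lt_trans KL.
have LB : L < L + 1 by rewrite ltrDl.
have svL i : supp L (component v i) by exact: supp_le (ltW KL) (sv i).
have spL : supp L p by exact: supp_le (ltW KL) spK.
have ray e y n (L' : R) : dot e e = 1 -> dot e y = 0 -> dot e n = 0 -> L <= L' ->
    seg e (- L') L' (fun x => vdot v e x * vdot v n x) y = 0.
  move=> ee ey en LL'.
  rewrite (seg_window (K := K) (L' := L))//; last 2 first.
  - by apply: suppM; exact: vdot_supp.
  - by rewrite K0.
    exact: (stress_lines_ray K0 smv smp sv spK heuler hw erefl erefl).
  by apply: contM; apply: C1_cont; exact: (vdot_C1 smv _).1.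
have frame e : dot e e = 1 -> exists F : 'I_3 -> 'rV[R]_3, orthonormal3 F /\ F i0 = e.
  move=> ee; have z0 : dot (0 : 'rV[R]_3) e = 0 by rewrite dot3 !mxE !mul0r !addr0.
  pose h0 := H (OrientedLine ee z0).
  exists (fun i : 'I_3 => nth 0 [:: e; inward h0; normal h0] i); split=> //.
  exact: (half_plane_frame h0).
split=> x.
  apply/rowP => i; rewrite mxE.
  exact: (velocity_eq0 L0 LB smv smp svL spL heuler hdiv ray frame).
exact: (pressure_eq0 L0 LB smv smp svL spL heuler hdiv ray frame).
Qed.
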